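(* Let $K\subset\mathbb{R}^n$ be a regular cone and let $F$ be a $\vartheta$-LHSCB for $K$ with negative curvature. Then $\xi_F\le 4/3$. Moreover, for every pair $x\in\operatorname{int}(K)$, $s\in\operatorname{int}(K^* )$, the integral scaling $$T:=\mu\int_0^1 F''\big((1-\alpha)x+\alpha\mu\tilde x\big)\,d\alpha$$ belongs to $\mathcal{T}(x,s;4/3)$.
   Context: A cone $K\subset\mathbb{R}^n$ is regular if it is a pointed, closed, convex cone with nonempty interior; its dual cone is $K^*=\{s\in\mathbb{R}^n:\langle s,x\rangle\ge 0\ \forall x\in K\}$. For symmetric matrices, $A\preceq B$ means $B-A$ is positive semidefinite; $\mathbb{S}^n_{++}$ is the set of symmetric positive definite $n\times n$ matrices. A $\vartheta$-logarithmically homogeneous self-concordant barrier ($\vartheta$-LHSCB) for $K$ is a closed convex function $F$ with domain $\operatorname{int}(K)$ (equal to $+\infty$ elsewhere), three times continuously differentiable on $\operatorname{int}(K)$, such that $F(tx)=F(x)-\vartheta\ln t$ for all $x\in\operatorname{int}(K)$, $t>0$, and $F'''(x;h)\preceq 2\|h\|_xF''(x)$ for all $x\in\operatorname{int}(K)$, $h\in\mathbb{R}^n$, where $\|h\|_x=\langle F''(x)h,h\rangle^{1/2}$ and $F'''(x;h)=\frac{d}{d\alpha}F''(x+\alpha h)|_{\alpha=0}$. $F$ has negative curvature if for every $u\in K$ the function $x\mapsto\langle F'(x),u\rangle$ is concave on $\operatorname{int}(K)$. The dual barrier is $F_*(s)=\sup_{x\in\operatorname{int}(K)}\{-\langle s,x\rangle-F(x)\}$,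 which is a $\vartheta$-LHSCB for $K^*$. For $x\in\operatorname{int}(K)$, $s\in\operatorname{int}(K^* )$ put $\tilde s=-F'(x)$, $\tilde x=-F_*'(s)$, $\mu=\langle s,x\rangle/\vartheta$, $\tilde\mu=\langle\tilde s,\tilde x\rangle/\vartheta$, and $$\delta_F(x,s)=\frac{\vartheta(\mu\tilde\mu-1)+1}{\mu}.$$ For $\xi>0$ define $$\mathcal{T}(x,s;\xi)=\Big\{T\in\mathbb{S}^n_{++}: Tx=s,\ T\tilde x=\tilde s,\ \tfrac{1}{\xi\delta_F(x,s)}F''(x)\preceq T\preceq\xi\delta_F(x,s)F_*''(s)^{-1}\Big\},$$ and $\xi_F=\inf\{\xi:\mathcal{T}(x,s;\xi)\ne\emptyset\ \text{for all } x\in\operatorname{int}(K),\,s\in\operatorname{int}(K^* )\}$. *)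

(* Defs.v *)
From HB Require Import structures.
From mathcomp Require Import all_boot all_order all_algebra.
From mathcomp Require Import all_classical all_reals all_analysis.
Set Implicit Arguments.
Unset Strict Implicit.
Unset Printing Implicit Defensive.
Import Order.TTheory GRing.Theory Num.Theory.
Import numFieldNormedType.Exports.
Local Open Scope classical_set_scope.
Local Open Scope ring_scope.

Section LinearAlgebra.
Context {R : realType} {n : nat}.
Implicit Types (A B : 'M[R]_n) (u v : 'cV[R]_n).

Definition inner u v : R := (u^T *m v) 0 0.

Definition psd A : Prop := A^T = A /\ forall v, 0 <= inner (A *m v) v.

Definition posdef A : Prop :=
  A^T = A /\ forall v, v != 0 -> 0 < inner (A *m v) v.

Definition loewner_le A B : Prop := psd (B - A).

End LinearAlgebra.

Section Cones.
Context {R : realType} {n : nat}.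
Implicit Type K : set 'cV[R]_n.

Record regular_cone K : Prop := RegularCone {
  regular_cone_scale : forall (t : R) x, 0 <= t -> K x -> K (t *: x) ;
  regular_cone_pointed : forall x, K x -> K (- x) -> x = 0 ;
  regular_cone_closed : closed K ;
  regular_cone_convex : convex_set K ;
  regular_cone_solid : K° !=set0 }.

Definition dual_cone K : set 'cV[R]_n :=
  [set s | forall x, K x -> 0 <= inner s x].

End Cones.

Section Calculus.
Context {R : realType} {n : nat}.
Implicit Types (D : set 'cV[R]_n) (f : 'cV[R]_n -> R) (F : 'cV[R]_n -> \bar R).

Definition partial (i : 'I_n) f (x : 'cV[R]_n) : R := 'D_(delta_mx i 0) f x.

(* [D] is meant to be open. *)
Fixpoint cont_diff (k : nat) D f : Prop :=
  if k is k'.+1 then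
    (forall x, D x -> differentiable f x) /\
    (forall i, cont_diff k' D (partial i f))
  else forall x, D x -> {for x, continuous f}.

Definition concave_function D f : Prop := convex_function D (fun x => - f x).

Definition epigraph F : set ('cV[R]_n * R) := [set p | (F p.1 <= p.2%:E)%E].

(* Derivatives of an extended-real-valued [F] are those of [fine \o F]; they
   are used only at points having a neighbourhood on which [F] is finite. *)
Definition grad F (x : 'cV[R]_n) : 'cV[R]_n :=
  \col_i partial i (fine \o F) x.

Definition hess F (x : 'cV[R]_n) : 'M[R]_n :=
  \matrix_(i, j) partial j (partial i (fine \o F)) x.

Definition third F (x h : 'cV[R]_n) : 'M[R]_n :=
  'D_h (hess F) x.

Definition local_norm F (x h : 'cV[R]_n) : R :=
  Num.sqrt (inner (hess F x *m h) h).

End Calculus.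

Section Barriers.
Context {R : realType} {n : nat}.
Variables (K : set 'cV[R]_n) (theta : R) (F : 'cV[R]_n -> \bar R).

Record LHSCB : Prop := Lhscb {
  LHSCB_fin : forall x, K° x -> F x \is a fin_num ;
  LHSCB_out : forall x, ~ K° x -> F x = +oo%E ;
  LHSCB_closed : closed (epigraph F) ;
  LHSCB_convex : convex_function K° (fine \o F) ;
  LHSCB_smooth : cont_diff 3 K° (fine \o F) ;
  LHSCB_homogeneous : forall x (t : R), K° x -> 0 < t ->
    F (t *: x) = (F x - (theta * ln t)%:E)%E ;
  LHSCB_self_concordant : forall x h, K° x ->
    loewner_le (third F x h) ((2 * local_norm F x h) *: hess F x) }.

Definition negative_curvature : Prop :=
  forall u, K u -> concave_function K° (fun x => inner (grad F x) u).

Definition dual_barrier (s : 'cV[R]_n) : \bar R :=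
  ereal_sup [set ((- inner s x)%:E - F x)%E | x in K°].

(* [shadow_s x] is s~ and [shadow_x s] is x~. *)
Definition shadow_s (x : 'cV[R]_n) : 'cV[R]_n := - grad F x.
Definition shadow_x (s : 'cV[R]_n) : 'cV[R]_n := - grad dual_barrier s.

Definition mu (x s : 'cV[R]_n) : R := inner s x / theta.
Definition mu_tilde (x s : 'cV[R]_n) : R :=
  inner (shadow_s x) (shadow_x s) / theta.

Definition delta (x s : 'cV[R]_n) : R :=
  (theta * (mu x s * mu_tilde x s - 1) + 1) / mu x s.

Definition scalings (x s : 'cV[R]_n) (xi : R) : set 'M[R]_n :=
  [set T | [/\ posdef T,
               T *m x = s,
               T *m shadow_x s = shadow_s x,
               loewner_le ((xi * delta x s)^-1 *: hess F x) T &
               loewner_le T ((xi * delta x s) *: invmx (hess dual_barrier s))]].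

(* The infimum is taken in [\bar R], so that it is [+oo] on the empty set. *)
Definition xi_inf : \bar R :=
  ereal_inf [set xi%:E | xi in [set xi : R | 0 < xi /\
    forall x s, K° x -> (dual_cone K)° s -> scalings x s xi !=set0]].

Definition integral_scaling (x s : 'cV[R]_n) : 'M[R]_n :=
  mu x s *: \matrix_(i, j)
    \int[lebesgue_measure]_(a in `[0, 1])
      (hess F ((1 - a) *: x + (a * mu x s) *: shadow_x s) i j).

End Barriers.

(* Main.v *)
(* Write p = mu x~ - x and r = |p|_x for the local norm at x.  The Dikin
   ellipsoid gives mu x~ <= (1 + r) x in the order of K.  Negative curvature makes
   F'' antitone along K, and F''(c y) = c^-2 F''(y), so that on the segment
   x_a = x + a p
     F''(x) / (1 + r a)^2 <= F''(x_a) <= ((1 + r) / (1 + r a))^2 F''(mu x~);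
   integrating, F''(x) / (1 + r) <= T / mu <= (1 + r) F''(mu x~).  The lower bound
   also shows that mu delta - 1 = <F'(mu x~) - F'(x), p> >= r^2 / (1 + r), whence
   1 + r <= 4/3 mu delta, because 4 (1 + r + r^2) - 3 (1 + r)^2 = (1 - r)^2.  The
   two linear equations for T follow from F''(y) y = - F'(y) and the fundamental
   theorem of calculus; finally F_*''(s)^-1 = F''(x~) because - F_*' is the
   inverse of - F'. *)
Require Import Defs.
From mathcomp Require Import all_boot all_order all_algebra.
From mathcomp Require Import all_classical all_reals all_analysis.
From mathcomp Require Import ring lra.
Set Implicit Arguments.
Unset Strict Implicit.
Unset Printing Implicit Defensive.
Import Order.TTheory GRing.Theory Num.Theory.
Import numFieldNormedType.Exports.
Local Open Scope classical_set_scope.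
Local Open Scope ring_scope.

(** * Inner products, positive definite matrices and cones *)

(** The constant 4/3 is the maximum of [(1 + r)^2 / (1 + r + r^2)] over [r >= 0], reached at
    [r = 1]. The factor mu in front of x~ is what makes [grad F] at mu x~ orthogonal to p: its
    pairings with x and with mu x~ both equal [- theta], so the gap reduces to
    [- inner (grad F x) p], which delta measures. Both Hessian comparisons come from the single cone
    vector [r *: x - p], so only the local norm at x enters. Two obstacles account for much of the
    length. Nondegeneracy and symmetry of [hess F] are not part of [LHSCB]: the first is extracted
    from the Dikin ellipsoid and pointedness, the second from the symmetry built into [loewner_le].
    And [dual_barrier] is only a supremum, so its two derivatives require a maximiser that exists
    and depends on s in a locally Lipschitz way; the lower bound [r^2 / (1 + r)] on the gap also
    yields that Lipschitz estimate. *)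

Section Inner.
Context {R : realType} {n : nat}.
Implicit Types (A B : 'M[R]_n) (u v w : 'cV[R]_n) (t : R).

Lemma innerE u v : inner u v = \sum_i u i 0 * v i 0.
Proof. by rewrite /inner mxE; apply: eq_bigr => i _; rewrite mxE. Qed.

Lemma innerC u v : inner u v = inner v u.
Proof. by rewrite !innerE; apply: eq_bigr => i _; rewrite mulrC. Qed.

Lemma innerDl u v w : inner (u + v) w = inner u w + inner v w.
Proof. by rewrite /inner linearD mulmxDl mxE. Qed.

Lemma innerZl t u v : inner (t *: u) v = t * inner u v.
Proof. by rewrite /inner linearZ -scalemxAl mxE. Qed.

Lemma innerNl u v : inner (- u) v = - inner u v.
Proof. by rewrite -scaleN1r innerZl mulN1r. Qed.

Lemma innerBl u v w : inner (u - v) w = inner u w - inner v w.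
Proof. by rewrite innerDl innerNl. Qed.

Lemma innerDr u v w : inner w (u + v) = inner w u + inner w v.
Proof. by rewrite !(innerC w) innerDl. Qed.

Lemma innerZr t u v : inner u (t *: v) = t * inner u v.
Proof. by rewrite !(innerC u) innerZl. Qed.

Lemma innerNr u v : inner u (- v) = - inner u v.
Proof. by rewrite !(innerC u) innerNl. Qed.

Lemma innerBr u v w : inner w (u - v) = inner w u - inner w v.
Proof. by rewrite !(innerC w) innerBl. Qed.

Lemma inner0l u : inner 0 u = 0.
Proof. by rewrite -(scale0r 0) innerZl mul0r. Qed.

Lemma inner_delta u i : inner u (delta_mx i 0) = u i 0.
Proof.
rewrite innerE (bigD1 i)//= big1 ?addr0; first by rewrite mxE !eqxx mulr1.
by move=> j ji; rewrite mxE (negbTE ji) mulr0.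
Qed.

Lemma inner_symm A u v : A^T = A -> inner (A *m u) v = inner (A *m v) u.
Proof.
by move=> At; rewrite [RHS]innerC /inner trmx_mul At mulmxA.
Qed.

Lemma le_coord_norm u i : `|u i 0| <= `|u|.
Proof.
by rewrite [leRHS]/Num.Def.normr/= mx_normrE; exact: (le_bigmax _ _ (i, ord0)).
Qed.

Lemma norm_le_coord u t : 0 <= t -> (forall i, `|u i 0| <= t) -> `|u| <= t.
Proof.
move=> t0 h; rewrite [leLHS]/Num.Def.normr/= mx_normrE.
by apply: bigmax_le => // -[i j] _; rewrite ord1.
Qed.

Lemma inner_le_norm u v : `|inner u v| <= n%:R * `|u| * `|v|.
Proof.
rewrite innerE (le_trans (ler_norm_sum _ _ _))//.
apply: (@le_trans _ _ (\sum_(i < n) `|u| * `|v|)).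
  by apply: ler_sum => i _; rewrite normrM ler_pM ?le_coord_norm.
by rewrite sumr_const card_ord -[leLHS]mulr_natl mulrA.
Qed.

Lemma posdef_ge0 A v : posdef A -> 0 <= inner (A *m v) v.
Proof.
by move=> [_ Ap]; have [->|/Ap/ltW//] := eqVneq v 0; rewrite mulmx0 inner0l.
Qed.

Lemma posdef_unitmx A : posdef A -> A \in unitmx.
Proof.
move=> [At Ap]; rewrite -row_free_unit -kermx_eq0; apply/eqP/row_matrixP => i.
rewrite row0; apply/eqP; apply: contraT => ri0.
have /Ap : (row i (kermx A))^T != 0 by rewrite -(inj_eq trmx_inj) trmxK trmx0.
rewrite -[X in X *m _]At -trmx_mul.
have /sub_kermxP -> : (row i (kermx A) <= kermx A)%MS by exact: row_sub.
by rewrite trmx0 inner0l ltxx.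
Qed.

Lemma posdef_cauchy_schwarz A u v : posdef A ->
  inner (A *m u) v ^+ 2 <= inner (A *m u) u * inner (A *m v) v.
Proof.
move=> [At Ap]; have [->|v0] := eqVneq v 0.
  by rewrite mulmx0 innerC !inner0l mulr0 expr0n.
set q := inner (A *m v) v; have q0 : 0 < q by exact: Ap.
set b := inner (A *m u) v; set a := inner (A *m u) u.
have := posdef_ge0 (u - (b / q) *: v) (conj At Ap).
rewrite mulmxBr -scalemxAr !innerBl !innerBr !innerZl !innerZr.
rewrite (inner_symm v u At) -/a -/b -/q => h.
rewrite -subr_ge0; suff -> : a * q - b ^+ 2 =
  q * (a - b / q * b - (b / q * b - b / q * (b / q * q))).
  by rewrite (mulr_ge0 (ltW q0)).
by field; rewrite gt_eqF.
Qed.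

(** Coordinate [i] of [v] is the [A]-inner product of [invmx A *m delta_mx i 0] with [v], so
    Cauchy-Schwarz for [A] bounds it by [d i] times the [A]-norm of [v]. The leading [1 +] keeps the
    constant positive. *)
Lemma posdef_norm_le A : posdef A ->
  exists2 C : R, 0 < C & forall v, `|v| <= C * Num.sqrt (inner (A *m v) v).
Proof.
move=> pA; have uA := posdef_unitmx pA.
pose d i := Num.sqrt (inner (delta_mx i 0) (invmx A *m delta_mx i 0)).
have sum0 : 0 <= \sum_i d i by apply: sumr_ge0 => i _; exact: sqrtr_ge0.
exists (1 + \sum_i d i) => [|v]; first by rewrite ltr_pwDl.
have rhs0 : 0 <= Num.sqrt (inner (A *m v) v) by exact: sqrtr_ge0.
apply: norm_le_coord => [|i]; first by rewrite mulr_ge0// addr_ge0.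
apply: (@le_trans _ _ (d i * Num.sqrt (inner (A *m v) v))); last first.
  rewrite ler_wpM2r// (bigD1 i)//= addrCA lerDl addr_ge0//.
  by apply: sumr_ge0 => j _; exact: sqrtr_ge0.
have := posdef_cauchy_schwarz (invmx A *m delta_mx i 0) v pA.
rewrite mulKVmx// [inner (delta_mx i 0) v]innerC inner_delta => h.
rewrite -sqrtr_sqr /d -sqrtrM; last first.
  by have := posdef_ge0 (invmx A *m delta_mx i 0) pA; rewrite mulKVmx.
exact: ler_wsqrtr.
Qed.

Lemma inner_continuous u : continuous (inner u : 'cV[R]_n -> R).
Proof.
rewrite (_ : inner u = fun v => \sum_i u i 0 * v i 0); last first.
  by apply/funext => w; rewrite innerE.
apply: continuous_big => [|i _ x]; first exact: (@add_continuous R).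
apply: (@continuousM _ _ (cst (u i 0)) (fun v : 'cV[R]_n => v i 0)).
  exact: cst_continuous.
exact: coord_continuous.
Qed.

End Inner.

Section Cone.
Context {R : realType} {n : nat} {K : set 'cV[R]_n}.
Hypothesis hK : regular_cone K.
Implicit Types (x y u v : 'cV[R]_n) (t : R).

Lemma cone_add x y : K x -> K y -> K (x + y).
Proof.
move=> Kx Ky.
have i01 : 0 <= (2^-1 : R) <= 1 by lra.
have := @regular_cone_convex _ _ _ hK x y (Itv01 (andP i01).1 (andP i01).2).
rewrite !inE => /(_ Kx Ky) /(regular_cone_scale hK (ler0n R 2)).
rewrite /conv/= scalerDr !scalerA.
rewrite (_ : 2 * (1 - 2^-1) = 1 :> R); last by lra.
by rewrite mulfV// !scale1r.
Qed.

Lemma int_cone_add x y : K° x -> K y -> K° (x + y).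
Proof.
move=> Kx Ky; have : \forall z \near x + y, K (z - y).
  have c : (fun z => z - y) @ (x + y) --> x.
    by rewrite -[X in _ --> X](addrK y x); exact: (cvgB cvg_id (cvg_cst _)).
  exact: c Kx.
rewrite /interior/=; apply: filterS => z Kz.
by rewrite -(subrK y z); exact: cone_add.
Qed.

Lemma int_cone_scale t x : 0 < t -> K° x -> K° (t *: x).
Proof.
move=> t0 Kx; have : \forall z \near t *: x, K (t^-1 *: z).
  have c : (fun z => t^-1 *: z) @ (t *: x) --> x.
    rewrite -[X in _ --> X](@scalerK _ _ t) ?gt_eqF//.
    exact: scaler_continuous.
  exact: c Kx.
rewrite /interior/=; apply: filterS => z Kz.
rewrite -(@scalerKV _ _ t _ z) ?gt_eqF//.
exact: (regular_cone_scale hK (ltW t0)).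
Qed.

Lemma int_cone_sub x : K° x -> K x.
Proof. exact: interior_subset. Qed.

Lemma int_cone_convex t x y : 0 <= t <= 1 -> K° x -> K° y ->
  K° ((1 - t) *: x + t *: y).
Proof.
move=> /andP[]; rewrite le_eqVlt => /predU1P[<-|t0 t1 Kx Ky].
  by rewrite subr0 scale1r scale0r addr0.
rewrite addrC; apply: int_cone_add; first exact: int_cone_scale.
by apply: (regular_cone_scale hK); [rewrite subr_ge0|exact: int_cone_sub].
Qed.

(** Were 0 interior, a small nonzero vector and its opposite would both lie in [K], against
    pointedness. *)
Lemma int_cone_neq0 x : (0 < n)%N -> K° x -> x != 0.
Proof.
move=> n0 Kx; apply/eqP => x0; have i0 : 'I_n := Ordinal n0.
pose e : 'cV[R]_n := delta_mx i0 0.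
have e0 : e != 0.
  by apply/eqP => /matrixP/(_ i0 0); rewrite !mxE !eqxx/= => /eqP; rewrite oner_eq0.
move: Kx; rewrite x0 => /nbhs_normP[d /= d0 dK].
have nd v : `|v| < d -> K v by move=> h; apply: dK; rewrite /ball_/= sub0r normrN.
have ne : 0 < `|e| by rewrite normr_gt0.
have small : `|(d / 2 / `|e|) *: e| < d.
  rewrite normrZ ger0_norm ?divr_ge0// ?ltW//.
  by rewrite divfK ?gt_eqF//; lra.
have : (d / 2 / `|e|) *: e = 0.
  by apply: (regular_cone_pointed hK); apply: nd; rewrite ?normrN.
by apply/eqP; rewrite scaler_eq0 negb_or e0 andbT gt_eqF// divr_gt0// divr_gt0.
Qed.

(** A whole ball around [s] lies in the dual cone, so [s] can be tilted by half the radius against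
    any coordinate of [x] and still pair nonnegatively with [x]. This bounds every coordinate, hence
    the sup norm. *)
Lemma dual_int_coercive s : (dual_cone K)° s ->
  exists2 c : R, 0 < c & forall x, K x -> c * `|x| <= inner s x.
Proof.
move=> /nbhs_normP[d /= d0 dK]; exists (d / 2) => [|x Kx]; first by rewrite divr_gt0.
have nD v : `|v| < d -> dual_cone K (s - v).
  by move=> h; apply: dK; rewrite /ball_/= opprB addrC subrK.
rewrite -ler_pdivlMl ?divr_gt0//.
have s0 : 0 <= inner s x.
  by have := nD 0; rewrite normr0 subr0 => /(_ d0)/(_ _ Kx).
apply: norm_le_coord => [|i]; first by rewrite mulr_ge0// invr_ge0 divr_ge0// ltW.
rewrite ler_pdivlMl ?divr_gt0//.
set v := ((d / 2) * Num.sg (x i 0)) *: (delta_mx i 0 : 'cV[R]_n).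
have : `|v| < d.
  apply: (@le_lt_trans _ _ (d / 2)); last by lra.
  apply: norm_le_coord => [|j]; first by lra.
  rewrite !mxE normrM (normrM (d / 2)) (ger0_norm (x := d / 2)); last by lra.
  rewrite -(mulrA (d / 2)) ler_piMr//; first by lra.
  rewrite mulr_ile1//; first by rewrite normr_sg; case: eqP.
  by case: (_ && _); rewrite ?normr1 ?normr0.
move=> /nD/(_ x Kx); rewrite innerBl subr_ge0 /v innerZl innerC inner_delta.
by rewrite -(mulrA (d / 2)) -normrEsg.
Qed.

End Cone.

(** * Derivatives along lines *)

Section OneVariable.
Context {R : realType}.
Implicit Types (f g df : R -> R) (a b c t : R).

Lemma is_derive_within_continuous f df a b :
  (forall t, a <= t <= b -> is_derive t 1 f (df t)) ->
  {within `[a, b], continuous f}.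
Proof.
move=> fd; apply: derivable_within_continuous => t; rewrite in_itv/= => /fd.
by case.
Qed.

Lemma is_derive_ge0_le f df a b : a <= b ->
  (forall t, a <= t <= b -> is_derive t 1 f (df t)) ->
  (forall t, a <= t <= b -> 0 <= df t) -> f a <= f b.
Proof.
move=> ab fd d0; rewrite -subr_ge0.
have [||c] := @MVT_segment R f df a b ab.
- by move=> t; rewrite in_itv/= => /andP[/ltW at_ /ltW tb]; apply: fd; rewrite at_.
- exact: is_derive_within_continuous fd.
by rewrite in_itv/= => /d0 dc0 ->; rewrite mulr_ge0// subr_ge0.
Qed.

Lemma is_derive_le f g df dg a b : a <= b ->
  (forall t, a <= t <= b -> is_derive t 1 f (df t)) ->
  (forall t, a <= t <= b -> is_derive t 1 g (dg t)) ->
  (forall t, a <= t <= b -> df t <= dg t) -> f b - f a <= g b - g a.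
Proof.
move=> ab fd gd h; suff : g a - f a <= g b - f b by lra.
apply: (@is_derive_ge0_le (g - f) (fun t => dg t - df t)) => // t tab.
  by apply: is_deriveB; [exact: gd|exact: fd].
by rewrite subr_ge0 h.
Qed.

Lemma is_derive_sumr (I : finType) (f df : I -> R -> R) t :
  (forall i, is_derive t 1 (f i) (df i t)) ->
  is_derive t 1 (fun t => \sum_i f i t) (\sum_i df i t).
Proof.
move=> fd; rewrite (_ : (fun t => _) = \sum_i f i); last first.
  by apply/funext => u; rewrite fct_sumE.
elim/big_ind2 : _ => //; first exact: is_derive_cst.
by move=> a b c d *; exact: is_deriveD.
Qed.

Lemma is_derive_mulrc f (l : R) c t : is_derive t 1 f l ->
  is_derive t 1 (fun t => f t * c) (l * c).
Proof.
move=> fd; rewrite (_ : (fun t => _) = c *: f); last first.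
  by apply/funext => u /=; rewrite mulrC.
by apply: is_derive_eq; rewrite mulrC.
Qed.

End OneVariable.

Section Lines.
Context {R : realType} {n : nat}.
Implicit Types (f : 'cV[R]_n -> R) (x h v : 'cV[R]_n) (t : R).

Lemma deriveE_partial f x h : differentiable f x ->
  'D_h f x = \sum_i h i 0 * partial i f x.
Proof.
move=> fx; rewrite deriveE// {1}(_ : h = \sum_i h i 0 *: delta_mx i 0); last first.
  by rewrite [LHS]matrix_sum_delta; apply: eq_bigr => i _; rewrite big_ord1.
rewrite linear_sum; apply: eq_bigr => i _; rewrite linearZ/=.
by rewrite /partial deriveE.
Qed.

Lemma is_derive_line f x h t : differentiable f (x + t *: h) ->
  is_derive t 1 (fun t => f (x + t *: h)) (\sum_i h i 0 * partial i f (x + t *: h)).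
Proof.
move=> fx; rewrite -deriveE_partial//.
have lt : is_diff t (fun t : R => x + t *: h) (fun t : R => t *: h).
  by apply: is_diff_eq; rewrite add0r.
have [ld le] := lt.
have dfl : differentiable (f \o (fun t : R => x + t *: h)) t.
  exact: differentiable_comp.
apply: DeriveDef; first exact/derivable1_diffP.
rewrite deriveE// diff_comp//=.
by rewrite le scale1r deriveE.
Qed.

End Lines.

(** * Derivatives and convexity of the barrier *)

(** If [l < 0], the derivative of [phi t + phi (- t)] is negative just to the right of 0, and the
    mean value theorem makes the second differences negative there. Convexity of [F] and negative
    curvature both become statements about Hessians through this lemma. *)
Lemma second_difference_ge0 (R : realType) (phi dphi : R -> R) (l d : R) :
  0 < d ->
  (forall t, - d <= t <= d -> is_derive t 1 phi (dphi t)) ->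
  is_derive (0 : R) 1 dphi l ->
  (forall t, 0 < t < d -> 0 <= phi t + phi (- t) - 2 * phi 0) ->
  0 <= l.
Proof.
move=> d0 pd dl h; rewrite leNgt; apply/negP => l0.
pose D t := phi t + phi (- t).
have Dd t : - d <= t <= d -> is_derive t 1 D (dphi t - dphi (- t)).
  move=> td; have p1 : is_derive t 1 phi (dphi t) by exact: pd.
  have p2 : is_derive (- t) 1 phi (dphi (- t)) by apply: pd; lra.
  have p3 : is_derive t 1 (phi \o -%R) (dphi (- t) * - 1).
    by apply: is_derive1_comp.
  by rewrite -[- dphi _]mulr1 mulNr -mulrN; exact: is_deriveD.
pose E t := dphi t - dphi (- t).
have Ed : is_derive (0 : R) 1 E (2 * l).
  have p2 : is_derive (- 0 : R) 1 dphi l by rewrite oppr0.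
  have p3 : is_derive (0 : R) 1 (dphi \o -%R) (l * - 1) by apply: is_derive1_comp.
  have -> : 2 * l = l - l * - 1 by ring.
  exact: is_deriveB.
have E0 : E 0 = 0 by rewrite /E oppr0 subrr.
have [e e0 En] : exists2 e, 0 < e & forall t, 0 < t < e -> E t < 0.
  have [] := Ed; rewrite /derivable => cvE dE.
  have : \forall t \near 0^', t^-1 *: (E (t *: 1 + 0) - E 0) < 0.
    have : (fun t => t^-1 *: (E (t *: 1 + 0) - E 0)) @ 0^' --> (2 * l : R).
      by move: cvE; rewrite -dE => /cvg_ex[/= a ca]; rewrite /derive (cvg_lim _ ca).
    move/cvgr_lt; apply; lra.
  move=> /nbhs_ballP[/= e e0 He]; exists e => // t /andP[t0 te].
  have := He t; rewrite /ball/= sub0r normrN gtr0_norm// => /(_ te).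
  rewrite gt_eqF// => /(_ isT); rewrite E0 subr0 addr0 /GRing.scale/= mulr1.
  by rewrite pmulr_rlt0// invr_gt0.
have [t [t0 td te]] : exists t, [/\ 0 < t, t < d & t < e].
  exists (Num.min d e / 2); have m0 : 0 < Num.min d e by rewrite lt_min d0.
  have [md me] : Num.min d e <= d /\ Num.min d e <= e.
    by rewrite !ge_min !lexx orbT.
  by split; lra.
have : 0 <= D t - D 0.
  by rewrite /D oppr0; have := h t; rewrite t0 td => /(_ isT); lra.
have [//|||c] := @MVT R D E 0 t.
- by move=> u; rewrite in_itv/= => ut; apply: Dd; lra.
- by apply: is_derive_within_continuous => u ut; apply: Dd; lra.
rewrite in_itv/= => ct -> h0.
have : E c * (t - 0) < 0 by rewrite pmulr_llt0 ?En//; lra.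
by lra.
Qed.

Section Smoothness.
Context {R : realType} {n : nat} {K : set 'cV[R]_n} {theta : R}
  {F : 'cV[R]_n -> \bar R}.
Hypotheses (hK : regular_cone K) (hF : LHSCB K theta F).
Implicit Types (x y u v h : 'cV[R]_n) (t : R).
Local Notation f := (fine \o F).

Lemma differentiable_F x : K° x -> differentiable f x.
Proof. by case: (LHSCB_smooth hF) => + _; exact. Qed.

Lemma differentiable_partial i x : K° x -> differentiable (partial i f) x.
Proof. by case: (LHSCB_smooth hF) => _ /(_ i)[+ _]; exact. Qed.

Lemma differentiable_partial2 i j x : K° x ->
  differentiable (partial j (partial i f)) x.
Proof. by case: (LHSCB_smooth hF) => _ /(_ i)[_ /(_ j)[+ _]]; exact. Qed.

Lemma is_derive_F x h t : K° (x + t *: h) ->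
  is_derive t 1 (fun t => f (x + t *: h)) (inner (grad F (x + t *: h)) h).
Proof.
move=> Kx; rewrite innerC innerE; under eq_bigr do rewrite mxE.
by apply: is_derive_line; exact: differentiable_F.
Qed.

Lemma is_derive_grad x h v t : K° (x + t *: h) ->
  is_derive t 1 (fun t => inner (grad F (x + t *: h)) v)
    (inner (hess F (x + t *: h) *m h) v).
Proof.
move=> Kx; rewrite innerE; under eq_fun do rewrite innerE.
apply: (is_derive_sumr (f := fun i t => grad F (x + t *: h) i 0 * v i 0)
  (df := fun i t => (hess F (x + t *: h) *m h) i 0 * v i 0)) => i.
apply: is_derive_mulrc; under eq_fun do rewrite mxE.
rewrite mxE; under eq_bigr do rewrite mxE mulrC.
by apply: is_derive_line; exact: differentiable_partial.
Qed.

Lemma third_entry x h i j : K° x ->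
  third F x h i j = \sum_k h k 0 * partial k (partial j (partial i f)) x.
Proof.
move=> Kx; have e a b : (fun y => hess F y a b) = partial b (partial a f).
  by apply/funext => y; rewrite mxE.
rewrite /third derive_mx.
  rewrite mxE e deriveE_partial//; exact: differentiable_partial2.
apply/derivable_mxP => a b; rewrite e; apply: diff_derivable.
exact: differentiable_partial2.
Qed.

Lemma is_derive_hess x h v u t : K° (x + t *: h) ->
  is_derive t 1 (fun t => inner (hess F (x + t *: h) *m v) u)
    (inner (third F (x + t *: h) h *m v) u).
Proof.
move=> Kx; rewrite innerE; under eq_fun do rewrite innerE.
apply: (is_derive_sumr (f := fun i t => (hess F (x + t *: h) *m v) i 0 * u i 0)
  (df := fun i t => (third F (x + t *: h) h *m v) i 0 * u i 0)) => i.
apply: is_derive_mulrc; under eq_fun do rewrite mxE; rewrite mxE.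
apply: (is_derive_sumr (f := fun j t => hess F (x + t *: h) i j * v j 0)
  (df := fun j t => third F (x + t *: h) h i j * v j 0)) => j.
apply: is_derive_mulrc; under eq_fun do rewrite mxE; rewrite third_entry//.
by apply: is_derive_line; exact: differentiable_partial2.
Qed.

Lemma int_cone_open x : K° x ->
  exists2 d : R, 0 < d & forall v, `|v| < d -> K° (x + v).
Proof.
move=> Kx; have : nbhs x K° by exact: nbhs_interior.
move=> /nbhs_normP[d /= d0 dK]; exists d => // v vd.
by apply: dK; rewrite /ball_/= opprD addrA subrr sub0r normrN.
Qed.

Lemma int_cone_line x h : K° x ->
  exists2 d : R, 0 < d & forall t, - d <= t <= d -> K° (x + t *: h).
Proof.
move=> /int_cone_open[d d0 dK]; exists (d / 2 / (1 + `|h|)).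
  by rewrite !divr_gt0// ltr_pwDl.
move=> t td; apply: dK; rewrite normrZ.
have h0 : 0 < 1 + `|h| by rewrite ltr_pwDl.
have : `|t| <= d / 2 / (1 + `|h|) by rewrite ler_norml.
rewrite ler_pdivlMr// => ht.
apply: (@le_lt_trans _ _ (d / 2)); last by lra.
by apply: le_trans ht; rewrite ler_wpM2l// lerDr.
Qed.

Lemma convex_midpoint (D : set 'cV[R]_n) (g : 'cV[R]_n -> R) x h :
  convex_function D g -> D (x + h) -> D (x - h) ->
  2 * g x <= g (x + h) + g (x - h).
Proof.
move=> cg Dx Dy.
have i01 : 0 <= (2^-1 : R) <= 1 by lra.
have := cg (Itv01 (andP i01).1 (andP i01).2) (x + h) (x - h).
rewrite !inE => /(_ Dx Dy); rewrite /conv/=.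
rewrite (_ : 2^-1 *: (x + h) + (1 - 2^-1) *: (x - h) = x); last first.
  have -> : 1 - 2^-1 = 2^-1 :> R by lra.
  rewrite -scalerDr addrACA subrr addr0 -mulr2n -[x *+ 2]scaler_nat scalerA mulVf//.
  by rewrite scale1r.
rewrite /conv/= /GRing.scale/=; rewrite /unstable.onem; lra.
Qed.

Lemma hess_ge0 x h : K° x -> 0 <= inner (hess F x *m h) h.
Proof.
move=> Kx; have [d d0 dK] := int_cone_line h Kx.
apply: (@second_difference_ge0 _ (fun t => f (x + t *: h))
  (fun t => inner (grad F (x + t *: h)) h) _ d) => //.
- by move=> t td; apply: is_derive_F; exact: dK.
- have := @is_derive_grad x h h 0; rewrite scale0r addr0; exact.
- move=> t td; rewrite scale0r addr0 scaleNr.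
  rewrite subr_ge0; apply: (@convex_midpoint K°); first exact: (LHSCB_convex hF).
    by apply: dK; lra.
  by rewrite -scaleNr; apply: dK; lra.
Qed.

Lemma segment_int x y t : 0 <= t <= 1 -> K° x -> K° y -> K° (x + t *: (y - x)).
Proof.
move=> t01 Kx Ky; have := int_cone_convex hK t01 Kx Ky.
by rewrite scalerBl scale1r scalerBr addrA addrAC.
Qed.

Lemma grad_mono x y : K° x -> K° y ->
  0 <= inner (grad F y - grad F x) (y - x).
Proof.
move=> Kx Ky; rewrite innerBl subr_ge0.
have Kt t : 0 <= t <= 1 -> K° (x + t *: (y - x)).
  by move=> ?; exact: segment_int.
have := @is_derive_ge0_le _ (fun t => inner (grad F (x + t *: (y - x))) (y - x))
  (fun t => inner (hess F (x + t *: (y - x)) *m (y - x)) (y - x)) 0 1 ler01.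
rewrite scale0r addr0 scale1r subrKC; apply => t t01.
  by apply: is_derive_grad; exact: Kt.
by apply: hess_ge0; exact: Kt.
Qed.

Lemma F_lower x y : K° x -> K° y -> f x + inner (grad F x) (y - x) <= f y.
Proof.
move=> Kx Ky.
have Kt t : 0 <= t <= 1 -> K° (x + t *: (y - x)) by move=> ?; exact: segment_int.
have := @is_derive_le _ (fun t => t * inner (grad F x) (y - x))
  (fun t => f (x + t *: (y - x))) (fun t => 1 * inner (grad F x) (y - x))
  (fun t => inner (grad F (x + t *: (y - x))) (y - x)) 0 1 ler01.
rewrite scale0r addr0 scale1r subrKC !mul0r !mul1r => h.
have {h} : inner (grad F x) (y - x) - 0 <= f y - f x.
  apply: h => t t01.
  - rewrite -{2}[inner _ _]mul1r; apply: is_derive_mulrc; exact: is_derive_id.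
  - by apply: is_derive_F; exact: Kt.
  - have := grad_mono Kx (Kt t t01); rewrite (addrAC x) subrr add0r innerZr.
    have [->|t0] := eqVneq t 0; first by rewrite scale0r addr0.
    rewrite pmulr_rge0 ?innerBl ?subr_ge0//.
    by move: t01 => /andP[t0' _]; rewrite lt_neqAle eq_sym t0.
by rewrite /=; lra.
Qed.

End Smoothness.

(** * Homogeneity *)

(** Both sides of the functional equation are differentiated in direction [v]. The case [a = 1],
    [c = - (theta * ln t)] gives the degree of the gradient, and [a = t^-1], [c = 0], applied to a
    partial derivative, that of the Hessian. *)
Lemma derive_homogeneous (R : realType) (n : nat) (g : 'cV[R]_n -> R)
    (a c t : R) (x v : 'cV[R]_n) :
  differentiable g (t *: x) -> differentiable g x ->
  (\forall z \near x, g (t *: z) = a * g z + c) ->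
  t * 'D_v g (t *: x) = a * 'D_v g x.
Proof.
move=> gtx gx e.
have sd : is_diff x ( *:%R t : 'cV[R]_n -> 'cV[R]_n) ( *:%R t).
  exact: is_diff_scaler.
have [sd1 sd2] := sd.
transitivity ('D_v (g \o *:%R t) x).
  rewrite [RHS]deriveE; last exact: differentiable_comp.
  have := congr1 (fun k : 'cV[R]_n -> R => k v) (diff_comp sd1 gtx).
  rewrite sd2 => E; rewrite [RHS]E.
  have -> : ('d g (t *: x) \o *:%R t) v = 'D_(t *: v) g (t *: x) by rewrite deriveE.
  rewrite !deriveE_partial// mulr_sumr; apply: eq_bigr => i _.
  by rewrite mxE mulrA.
rewrite (near_eq_derive (g := fun z => a * g z + c))//.
have dg : derivable g x v by exact: diff_derivable.
rewrite -[fun z => _]/(a *: g + cst c) deriveD;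
  [|exact: derivableZ|exact: derivable_cst].
by rewrite (deriveZ a dg) derive_cst addr0.
Qed.

Section Homogeneity.
Context {R : realType} {n : nat} {K : set 'cV[R]_n} {theta : R}
  {F : 'cV[R]_n -> \bar R}.
Hypotheses (hK : regular_cone K) (hF : LHSCB K theta F).
Implicit Types (x y u v h : 'cV[R]_n) (t : R).
Local Notation f := (fine \o F).

Lemma F_fin x : K° x -> F x = (f x)%:E.
Proof. by move=> Kx; rewrite /= fineK// (LHSCB_fin hF). Qed.

Lemma F_homogeneous x t : K° x -> 0 < t -> f (t *: x) = f x - theta * ln t.
Proof.
by move=> Kx t0; rewrite /= (LHSCB_homogeneous hF)// F_fin.
Qed.

Lemma partial_homogeneous i x t : K° x -> 0 < t ->
  partial i f (t *: x) = t^-1 * partial i f x.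
Proof.
move=> Kx t0; have := @derive_homogeneous R n f 1 (- (theta * ln t)) t x (delta_mx i 0).
move=> h; rewrite /partial -[X in _ = _ * X]mul1r -h ?mulKf ?gt_eqF//.
- by apply: (differentiable_F hF); exact: int_cone_scale.
- exact: (differentiable_F hF).
have : \forall z \near x, K° z by exact: nbhs_interior.
by apply: filterS => z Kz; rewrite F_homogeneous// mul1r.
Qed.

Lemma partial2_homogeneous i j x t : K° x -> 0 < t ->
  partial j (partial i f) (t *: x) = t^-1 ^+ 2 * partial j (partial i f) x.
Proof.
move=> Kx t0; have := @derive_homogeneous R n (partial i f) t^-1 0 t x (delta_mx j 0).
rewrite -!/(partial j _ _) => h.
suff e : t * partial j (partial i f) (t *: x) = t^-1 * partial j (partial i f) x.
  by rewrite [LHS](canRL (mulKf (lt0r_neq0 t0)) e) mulrA.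
apply: h.
- by apply: (differentiable_partial hF); exact: int_cone_scale.
- exact: (differentiable_partial hF).
have : \forall z \near x, K° z by exact: nbhs_interior.
by apply: filterS => z Kz; rewrite partial_homogeneous// addr0.
Qed.

Lemma grad_homogeneous x t : K° x -> 0 < t -> grad F (t *: x) = t^-1 *: grad F x.
Proof. by move=> Kx t0; apply/matrixP => i j; rewrite !mxE partial_homogeneous. Qed.

Lemma hess_homogeneous x t : K° x -> 0 < t ->
  hess F (t *: x) = t^-1 ^+ 2 *: hess F x.
Proof. by move=> Kx t0; apply/matrixP => i j; rewrite !mxE partial2_homogeneous. Qed.

Lemma near1_gt0 : \forall s \near (1 : R), 0 < s.
Proof. by apply: (@lt_nbhsr R); exact: ltr01. Qed.

(** Euler's relation: the two expressions of [f (s *: x)] near [s = 1] are differentiated at 1. The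
    next lemma does the same with the partial derivatives, homogeneous of degree -1. *)
Lemma inner_grad_self x : K° x -> inner (grad F x) x = - theta.
Proof.
move=> Kx; have := @is_derive_F _ _ _ _ _ hF 0 x 1; rewrite add0r scale1r => /(_ Kx).
under eq_fun do rewrite add0r.
move=> [_ <-]; rewrite (near_eq_derive (g := fun s : R => f x - theta * ln s)).
  have l1 : is_derive (1 : R) 1 (@ln R) 1^-1 by apply: is_derive1_ln; exact: ltr01.
  have := @is_deriveB _ _ _ _ _ _ _ _ _ (is_derive_cst (f x) (1 : R) (1 : R))
    (is_deriveZ theta l1).
  by move=> [_]; rewrite sub0r invr1 /GRing.scale/= mulr1; apply: etrans.
by have := near1_gt0; apply: filterS => s s0; rewrite F_homogeneous.
Qed.

Lemma hess_mul_self x : K° x -> hess F x *m x = - grad F x.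
Proof.
move=> Kx; apply/matrixP => i j; rewrite ord1 !mxE {j}.
have := @is_derive_line _ _ (partial i f) 0 x 1; rewrite add0r scale1r.
move=> /(_ (differentiable_partial hF _ Kx)).
under eq_fun do rewrite add0r.
move=> [_]; under [X in _ = X -> _]eq_bigr do rewrite mulrC.
under [X in _ -> X = _]eq_bigr do rewrite mxE.
move=> <-; rewrite (near_eq_derive (g := fun s : R => partial i f x * s^-1)).
  have l1 : is_derive (1 : R) 1 (fun s : R => s^-1) (- 1 ^- 2 *: 1).
    by apply: (is_deriveV (f := id)); rewrite ?oner_neq0.
  have [_] := is_deriveZ (partial i f x) l1.
  by rewrite expr1n invr1 /GRing.scale/= mulr1 mulrN1; apply: etrans.
by have := near1_gt0; apply: filterS => s s0; rewrite partial_homogeneous// mulrC.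
Qed.

End Homogeneity.

(** * The Dikin ellipsoid and negative curvature *)

(* [1 / sqrt psi] decreases at unit speed at most; the shift of [psi] by [e]
   keeps the square root away from [0]. *)
Lemma self_concordant_bound (R : realType) (psi dpsi : R -> R) (T : R) :
  T <= 1 ->
  (forall t, 0 <= t < T -> is_derive t 1 psi (dpsi t)) ->
  (forall t, 0 <= t < T -> 0 <= psi t) ->
  (forall t, 0 <= t < T -> dpsi t <= 2 * Num.sqrt (psi t) * psi t) ->
  psi 0 < 1 ->
  exists M, forall t, 0 <= t < T -> psi t <= M.
Proof.
move=> T1 pd p0 dp p1.
have [T0|T0] := leP T 0; first by exists 0 => t tT; exfalso; lra.
have p00 : 0 <= psi 0 by apply: p0; lra.
(* This choice keeps [psi 0 + e] below 1, so [(q 0)^-1] exceeds 1; a decrease at unit speed over a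
   time below 1 then leaves the positive margin [c]. *)
pose e := (1 - psi 0) / 2.
have e0 : 0 < e by rewrite /e; lra.
pose q t := Num.sqrt (psi t + e).
have q0 t : 0 <= t < T -> 0 < q t by move=> /p0 h; rewrite sqrtr_gt0; lra.
have qq t : 0 <= t < T -> q t ^+ 2 = psi t + e.
  by move=> /p0 h; rewrite sqr_sqrtr//; lra.
have qd t : 0 <= t < T ->
    is_derive t 1 (fun t => (q t)^-1) (- (q t) ^- 2 * ((2 * q t)^-1 * dpsi t)).
  move=> tT; apply: is_deriveV; first by rewrite gt_eqF// q0.
  apply: (is_derive1_comp (f := Num.sqrt) (g := fun t => psi t + e)).
    by apply: is_derive1_sqrt; rewrite -sqrtr_gt0; exact: q0.
  rewrite -[dpsi t]addr0; apply: is_deriveD.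
  exact: pd.
have q00 : q 0 < 1.
  by rewrite -sqrtr1 ltr_sqrt// /e; lra.
have cq : 1 < (q 0)^-1 by rewrite invf_gt1// q0//; lra.
pose c := (q 0)^-1 - 1.
exists (c^-1 ^+ 2) => t tT.
have qt := q0 t tT.
have tq : c <= (q t)^-1.
  have := @is_derive_le _ (fun t => - 1 * t) (fun t => (q t)^-1) (fun t => - 1)
   (fun t => - (q t) ^- 2 * ((2 * q t)^-1 * dpsi t)) 0 t.
  rewrite /c => h; suff : - 1 * t - - 1 * 0 <= (q t)^-1 - (q 0)^-1 by lra.
  apply: h => [|s st|s st|s st]; first by lra.
  - have -> : (fun t : R => -1 * t) = -%R by apply/funext => u; rewrite mulN1r.
    exact: is_deriveNid.
  - by apply: qd; lra.
  have sT : 0 <= s < T by lra.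
  have qs := q0 s sT.
  have : dpsi s <= 2 * q s ^+ 3.
    apply: le_trans (dp s sT) _; rewrite -mulrA ler_pM2l// exprS.
    apply: ler_pM => //; rewrite ?sqrtr_ge0//; first exact: p0.
      by rewrite ler_wsqrtr// lerDl ltW.
    by rewrite qq//; lra.
  rewrite mulNr lerN2 => h3.
  have -> : (q s) ^- 2 * ((2 * q s)^-1 * dpsi s) = (2 * q s ^+ 3)^-1 * dpsi s.
    by field; rewrite gt_eqF.
  by rewrite ler_pdivrMl ?mulr1// mulr_gt0// exprn_gt0.
have c0 : 0 < c by rewrite /c; lra.
have : q t <= c^-1 by rewrite -[q t]invrK lef_pV2 ?posrE// invr_gt0.
move=> h; apply: (@le_trans _ _ (q t ^+ 2)).
  by rewrite qq//; lra.
by rewrite !expr2 ler_pM// ltW.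
Qed.

Section Dikin.
Context {R : realType} {n : nat} {K : set 'cV[R]_n} {theta : R}
  {F : 'cV[R]_n -> \bar R}.
Hypotheses (hK : regular_cone K) (hF : LHSCB K theta F).
Implicit Types (x y u v h : 'cV[R]_n) (t : R).
Local Notation f := (fine \o F).

(** Closedness of the epigraph carries the finite bound to the endpoint, while [F] is [+oo] off the
    interior. *)
Lemma barrier_unbounded x h (T B : R) : 0 < T ->
  (forall t, 0 <= t < T -> K° (x + t *: h)) ->
  (forall t, 0 <= t < T -> f (x + t *: h) <= B) -> K° (x + T *: h).
Proof.
move=> T0 Kt fB; apply: contrapT => nK.
suff : epigraph F (x + T *: h, B) by rewrite /epigraph/= (LHSCB_out hF).
apply: (@closed_cvg _ _ T^'- _ (fun t => (x + t *: h, B)) _ (LHSCB_closed hF)).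
  near=> t; have tT : 0 <= t < T.
    apply/andP; split; [apply: ltW|]; near: t; first exact: nbhs_left_gt.
    exact: nbhs_left_lt.
  by rewrite /epigraph/= (F_fin hF) ?lee_fin; [exact: fB|exact: Kt].
have c : x + t *: h @[t --> T^'-] --> x + T *: h.
  apply: cvg_at_left_filter.
  by apply: (cvgD (cvg_cst _)); exact: scalel_continuous.
exact: (cvg_pair c (cvg_cst _)).
Unshelve. all: by end_near. Qed.

(** Let [T <= 1] be the first exit time of the ray. Self-concordance says that [psi t], the Hessian
    form of [h] at [x + t *: h], has derivative at most [2 * psi t] times the square root of
    [psi t]; as [psi 0 < 1], it stays bounded on [[0, T)]. Integrating twice bounds [F] there, so
    the exit point is interior after all. *)
Lemma dikin x h : K° x -> inner (hess F x *m h) h < 1 -> K° (x + h).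
Proof.
move=> Kx h1; apply: contrapT => nK.
pose A := [set t : R | 0 <= t <= 1 /\ ~ K° (x + t *: h)].
have A1 : A 1 by split; [lra|rewrite scale1r].
have lA : has_inf A by split; [exists 1|exists 0 => t [/andP[]]].
set T := inf A.
have T0 : 0 <= T by apply: lb_le_inf => [|t [/andP[]]//]; exists 1.
have T1 : T <= 1 by apply: ge_inf => //; case: lA.
have Kt t : 0 <= t < T -> K° (x + t *: h).
  move=> /andP[t0 tT]; apply: contrapT => nKt.
  have : T <= t by apply: ge_inf; [case: lA|split => //; lra].
  by lra.
(* The interior is open, so the infimum of the exit times is itself an exit time. *)
have nKT : ~ K° (x + T *: h).
  move=> KT; have [d d0 dK] := int_cone_line h KT.
  have [a [a01 nKa] aT] := inf_adherent d0 lA.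
  have Ta : T <= a by apply: ge_inf; [case: lA|split].
  apply: nKa; rewrite (_ : a = T + (a - T)); last by lra.
  rewrite scalerDl addrA; apply: dK; rewrite /T in Ta *; lra.
have {}T0 : 0 < T.
  rewrite lt_neqAle T0 andbT; apply/eqP => T00; apply: nKT.
  by rewrite -T00 scale0r addr0.
have [M MP] : exists M, forall t, 0 <= t < T ->
    inner (hess F (x + t *: h) *m h) h <= M.
  apply: (@self_concordant_bound _ _
    (fun t => inner (third F (x + t *: h) h *m h) h) T T1) => [t tT|t tT|t tT|].
  - by apply: (is_derive_hess hF); exact: Kt.
  - by apply: (hess_ge0 hF); exact: Kt.
  - have [_ /(_ h)] := LHSCB_self_concordant hF h (Kt t tT).
    by rewrite mulmxBl -scalemxAl innerBl innerZl subr_ge0.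
  - by rewrite scale0r addr0.
apply: nKT; pose g0 := inner (grad F x) h.
apply: (@barrier_unbounded x h T (f x + `|g0 + `|M| |) T0 Kt) => t tT.
have gM s : 0 <= s <= t -> inner (grad F (x + s *: h)) h <= g0 + `|M|.
  move=> st; have := @is_derive_le _ (fun s => inner (grad F (x + s *: h)) h)
    (fun s => s * `|M|) (fun s => inner (hess F (x + s *: h) *m h) h)
    (fun s => 1 * `|M|) 0 s.
  rewrite scale0r addr0 -/g0 mul0r subr0 mul1r => H.
  have : inner (grad F (x + s *: h)) h - g0 <= s * `|M|.
    apply: H => [|r rs|r rs|r rs]; first by lra.
    - by apply: (is_derive_grad hF); apply: Kt; lra.
    - rewrite -{2}[`|M|]mul1r; apply: is_derive_mulrc; exact: is_derive_id.
    - by apply: (@le_trans _ _ M); [apply: MP; lra|exact: ler_norm].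
  have : s * `|M| <= `|M| by rewrite ler_piMl//; lra.
  by lra.
have := @is_derive_le _ (fun s => f (x + s *: h)) (fun s => s * (g0 + `|M|))
  (fun s => inner (grad F (x + s *: h)) h) (fun s => 1 * (g0 + `|M|)) 0 t.
rewrite scale0r addr0 mul0r subr0 mul1r => H.
have : f (x + t *: h) - f x <= t * (g0 + `|M|).
  apply: H => [|r rs|r rs|r rs]; first by lra.
  - by apply: (is_derive_F hF); apply: Kt; lra.
  - rewrite -{2}[g0 + _]mul1r; apply: is_derive_mulrc; exact: is_derive_id.
  - exact: gM.
have : t * (g0 + `|M|) <= `|g0 + `|M| |.
  apply: le_trans (ler_norm _) _; rewrite normrM ler_piMl// ger0_norm; lra.
by rewrite /=; lra.
Qed.

(** Enlarging [r] to [r + e] makes the inequality strict, so that [dikin] applies to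
    [(r + e)^-1 *: h]; then [e] tends to 0 in the closed cone. *)
Lemma dikin_le x h r : K° x -> 0 < r -> inner (hess F x *m h) h <= r ^+ 2 ->
  K (r *: x + h).
Proof.
move=> Kx r0 hr; apply: (regular_cone_closed hK).
have := @closed_cvg _ _ (0 : R)^'+ _ (fun e => (r + e) *: x + h) (closure K)
  (@closed_closure _ K).
apply.
  near=> e; apply: subset_closure; apply: int_cone_sub.
  have e0 : 0 < e by near: e; exact: nbhs_right_gt.
  have re : 0 < r + e by lra.
  rewrite -[X in K° X](@scalerKV _ _ (r + e)) ?gt_eqF//.
  apply: (int_cone_scale hK re).
  rewrite scalerDr scalerK ?gt_eqF//; apply: dikin => //.
  rewrite -scalemxAr innerZl innerZr mulrA -expr2 exprVn mulrC.
  rewrite ltr_pdivrMr ?exprn_gt0// mul1r (le_lt_trans hr)//.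
  by rewrite ltr_pXn2r// ?nnegrE; lra.
apply: cvg_at_right_filter.
rewrite -[X in _ --> X]/(r *: x + h) -[X in X *: x + h]addr0.
apply: (cvgD _ (cvg_cst _)).
apply: (cvg_comp (fun e => r + e) (fun k => k *: x)); last exact: scalel_continuous.
exact: (cvgD (cvg_cst _) cvg_id).
Unshelve. all: by end_near. Qed.

(** A null direction [h] would put the whole line through [x] inside the Dikin ellipsoid, hence
    inside the cone. Then [h] and [- h] are limits of cone points, and pointedness gives [h = 0]. *)
Lemma hess_gt0 x h : K° x -> h != 0 -> 0 < inner (hess F x *m h) h.
Proof.
move=> Kx h0; rewrite lt_neqAle (hess_ge0 hF)// andbT.
apply/negP => /eqP q0; move/eqP: h0; apply.
have Kr t : K° (x + t *: h).
  by apply: dikin => //; rewrite -scalemxAr innerZl innerZr -q0 !mulr0.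
have Kh (v : 'cV[R]_n) : (forall t, K° (x + t *: v)) -> K v.
  move=> Kv; apply: (regular_cone_closed hK).
  apply: (@closed_cvg _ _ (0 : R)^'+ _ (fun e => e *: x + v) (closure K)
    (@closed_closure _ K)).
    near=> e; apply: subset_closure; apply: int_cone_sub.
    have e0 : 0 < e by near: e; exact: nbhs_right_gt.
    rewrite -[X in K° X](@scalerKV _ _ e) ?gt_eqF//.
    apply: (int_cone_scale hK e0).
    by rewrite scalerDr scalerK ?gt_eqF//; exact: Kv.
  have c : e *: x + v @[e --> (0 : R)^'+] --> 0 *: x + v.
    apply: cvg_at_right_filter.
    apply: (cvgD _ (cvg_cst _)); exact: scalel_continuous.
  by move: c; rewrite scale0r add0r.
have KN t : K° (x + t *: (- h)) by rewrite scalerN -scaleNr.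
exact: (regular_cone_pointed hK (Kh h Kr) (Kh (- h) KN)).
Unshelve. all: by end_near. Qed.

Lemma third_opp x h : K° x -> third F x (- h) = - third F x h.
Proof.
move=> Kx; apply/matrixP => i j.
have opp_entry (A : 'M[R]_n) : (- A) i j = - A i j by rewrite mxE.
apply: etrans (third_entry hF (- h) i j Kx) _; apply/esym.
apply: etrans (opp_entry _) _.
apply: etrans (congr1 -%R (third_entry hF h i j Kx)) _.
by rewrite -sumrN; apply: eq_bigr => k _; rewrite mxE mulNr.
Qed.

(** [loewner_le] asserts symmetry of a difference. Adding the self-concordance conditions for [h]
    and [- h] cancels the third derivative, which is odd in [h], and leaves a positive multiple of
    the Hessian. *)
Lemma hess_symm x : (0 < n)%N -> K° x -> (hess F x)^T = hess F x.
Proof.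
move=> n0 Kx; pose h : 'cV[R]_n := const_mx 1.
have h0 : h != 0.
  apply/eqP => /matrixP/(_ (Ordinal n0) 0); rewrite !mxE => /eqP.
  by rewrite oner_eq0.
have nh : local_norm F x (- h) = local_norm F x h.
  by rewrite /local_norm mulmxN innerNl innerNr opprK.
have [s1 _] := LHSCB_self_concordant hF h Kx.
have [s2 _] := LHSCB_self_concordant hF (- h) Kx.
have l0 : 0 < local_norm F x h by rewrite sqrtr_gt0 hess_gt0.
move: s1 s2; rewrite third_opp// nh opprK => s1 s2.
have := congr2 +%R s1 s2; rewrite -linearD/=.
rewrite addrACA addNr addr0 -scalerDl linearZ/=.
by apply: scalerI; rewrite gt_eqF// addr_gt0// mulr_gt0.
Qed.

Lemma hess_posdef x : K° x -> posdef (hess F x).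
Proof.
move=> Kx; split; last by move=> v; exact: hess_gt0.
have [n0|] := posnP n; last by move=> n0; exact: hess_symm.
by apply/matrixP => i; have := ltn_ord i; rewrite [X in (_ < X)%N]n0.
Qed.

Lemma theta_gt0 x : (0 < n)%N -> K° x -> 0 < theta.
Proof.
move=> n0 Kx; have := hess_gt0 Kx (int_cone_neq0 hK n0 Kx).
by rewrite (hess_mul_self hK hF)// innerNl (inner_grad_self hF)// opprK.
Qed.

Hypothesis hneg : negative_curvature K F.

(** The difference of the two Hessian forms is the second derivative at 0 of
    [f (y + t *: h) - f (y + u + t *: h)]. Working with second differences of [f] avoids permuting
    mixed third derivatives. *)
Lemma hess_antitone y u h : K° y -> K u ->
  inner (hess F (y + u) *m h) h <= inner (hess F y *m h) h.
Proof.
move=> Ky Ku; have [d d0 dK] := int_cone_line h Ky.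
have Kyu t : - d <= t <= d -> K° (y + u + t *: h).
  by move=> /dK Kt; rewrite addrAC; exact: int_cone_add.
rewrite -subr_ge0.
apply: (@second_difference_ge0 _ (fun t => f (y + t *: h) - f (y + u + t *: h))
  (fun t => inner (grad F (y + t *: h)) h -
    inner (grad F (y + u + t *: h)) h) _ d) => //.
- move=> t td; apply: is_deriveB; apply: (is_derive_F hF); [exact: dK|exact: Kyu].
- apply: is_deriveB.
    by have := @is_derive_grad _ _ _ _ _ hF y h h 0; rewrite scale0r addr0; exact.
  have := @is_derive_grad _ _ _ _ _ hF (y + u) h h 0; rewrite scale0r addr0; apply.
  exact: int_cone_add.
move=> t /andP[t0 td].
have Kp : K° (y + t *: h) by apply: dK; lra.
have Km : K° (y - t *: h) by rewrite -scaleNr; apply: dK; lra.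
rewrite scale0r !addr0 !scaleNr.
have Ks s z : 0 <= s -> K° z -> K° (z + s *: u).
  by move=> s0 Kz; apply: int_cone_add => //; exact: (regular_cone_scale hK).
(* The second difference of [f] in direction [h] is followed along [y + s *: u] for [s] from 0 to 1.
   Its derivative in [s] is a second difference of the concave function [inner (grad F _) u], hence
   nonpositive. *)
have := @is_derive_le _
  (fun s => f (y + t *: h + s *: u) + f (y - t *: h + s *: u))
  (fun s => f (y + s *: u) + f (y + s *: u))
  (fun s => inner (grad F (y + t *: h + s *: u)) u
          + inner (grad F (y - t *: h + s *: u)) u)
  (fun s => inner (grad F (y + s *: u)) u + inner (grad F (y + s *: u)) u) 0 1 ler01.
rewrite !scale0r !addr0 !scale1r => H.
have {}H : f (y + t *: h + u) + f (y - t *: h + u) -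
    (f (y + t *: h) + f (y - t *: h))
  <= f (y + u) + f (y + u) - (f y + f y).
  apply: H => s /andP[s0 _].
  - by apply: is_deriveD; apply: (is_derive_F hF); exact: Ks.
  - by apply: is_deriveD; apply: (is_derive_F hF); exact: Ks.
  have := @convex_midpoint _ _ K° _ (y + s *: u) (t *: h) (hneg Ku).
  rewrite ![_ + s *: u + _]addrAC => /(_ (Ks _ _ s0 Kp) (Ks _ _ s0 Km)).
  by rewrite mulrN -opprD lerN2 mulr_natl mulr2n.
rewrite [y + u + _]addrAC [y + u - _]addrAC.
by move: H; rewrite /=; lra.
Qed.

End Dikin.

(** * Comparison of Hessians on a segment *)

Lemma is_derive_affine (R : realType) (r a : R) :
  is_derive a 1 (fun a => 1 + r * a) r.
Proof.
have := is_deriveD (is_derive_cst (1 : R) a 1) (is_deriveZ r (is_derive_id a 1)).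
by rewrite add0r /GRing.scale/= mulr1.
Qed.

(** This antiderivative of [(1 + r * a) ^- 2] vanishes at 0 and remains valid for [r = 0], unlike
    the one with [r] in the denominator. *)
Lemma is_derive_homography (R : realType) (r a : R) : 1 + r * a != 0 ->
  is_derive a 1 (fun a => a * (1 + r * a)^-1) ((1 + r * a) ^- 2).
Proof.
move=> h; have d2 := is_deriveV (f := fun a => 1 + r * a) h (is_derive_affine r a).
have [d3 e3] := is_deriveM (is_derive_id a (1 : R)) d2.
apply: DeriveDef; first exact: d3.
rewrite [LHS]e3 /GRing.scale/= /GRing.scale/=; field.
exact: h.
Qed.

Section SegmentComparison.
Context {R : realType} {n : nat} {K : set 'cV[R]_n} {theta : R}
  {F : 'cV[R]_n -> \bar R}.
Hypotheses (hK : regular_cone K) (hF : LHSCB K theta F)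
  (hneg : negative_curvature K F).
Implicit Types (x y u v h : 'cV[R]_n) (t : R).
Local Notation f := (fine \o F).

Lemma local_norm_ge0 x h : 0 <= local_norm F x h.
Proof. exact: sqrtr_ge0. Qed.

Lemma local_norm_sqr x h : K° x ->
  local_norm F x h ^+ 2 = inner (hess F x *m h) h.
Proof. by move=> Kx; rewrite sqr_sqrtr// (hess_ge0 hF). Qed.

Lemma local_norm_eq0 x h : K° x -> local_norm F x h = 0 -> h = 0.
Proof.
move=> Kx e; apply/eqP; apply: contraT => /(hess_gt0 hK hF Kx).
by rewrite -local_norm_sqr// e expr0n ltxx.
Qed.

Lemma cone0 : K 0.
Proof.
have [e Ke] := regular_cone_solid hK.
by rewrite -(scale0r e); apply: (regular_cone_scale hK) => //; exact: int_cone_sub.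
Qed.

(** The Dikin ellipsoid is applied to the opposite displacement [- (y - x)]. A zero local norm,
    excluded by [dikin_le], forces the displacement to vanish. *)
Lemma cone_local_norm x y : K° x ->
  K (local_norm F x (y - x) *: x - (y - x)).
Proof.
move=> Kx; have := local_norm_ge0 x (y - x); rewrite le_eqVlt => /predU1P[e|r0].
  rewrite -e scale0r sub0r (local_norm_eq0 Kx (esym e)) oppr0; exact: cone0.
apply: (dikin_le hK hF) => //.
by rewrite mulmxN innerNl innerNr opprK local_norm_sqr.
Qed.

(** Adding [a] times the cone vector of [cone_local_norm] to the segment point gives exactly
    [(1 + r * a) *: x], where the Hessian is known by homogeneity and can only be smaller. *)
Lemma hess_segment_lower x y a h : K° x -> K° y -> 0 <= a <= 1 ->
  (1 + local_norm F x (y - x) * a) ^- 2 * inner (hess F x *m h) h <=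
  inner (hess F (x + a *: (y - x)) *m h) h.
Proof.
move=> Kx Ky a01; set r := local_norm F x (y - x).
have r0 : 0 <= r by exact: local_norm_ge0.
have ra : 0 < 1 + r * a by rewrite ltr_pwDl// mulr_ge0//; lra.
have Ka := segment_int hK a01 Kx Ky.
have := @hess_antitone _ _ _ _ _ hK hF hneg _ (a *: (r *: x - (y - x))) h Ka.
have -> : x + a *: (y - x) + a *: (r *: x - (y - x)) = (1 + r * a) *: x.
  by rewrite -addrA -scalerDr subrKC scalerA [a * r]mulrC -{1}[x]scale1r scalerDl.
rewrite (hess_homogeneous hK hF)// -scalemxAl innerZl exprVn; apply.
apply: (regular_cone_scale hK); first by lra.
exact: cone_local_norm.
Qed.

Lemma hess_segment_upper x y a h : K° x -> K° y -> 0 <= a <= 1 -> forall r,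
  r = local_norm F x (y - x) ->
  inner (hess F (x + a *: (y - x)) *m h) h <=
  (1 + r) ^+ 2 * (1 + r * a) ^- 2 * inner (hess F y *m h) h.
Proof.
move=> Kx Ky a01 r rE.
have r0 : 0 <= r by rewrite rE; exact: local_norm_ge0.
have ra : 0 < 1 + r * a by rewrite ltr_pwDl// mulr_ge0//; lra.
have r1 : 0 < 1 + r by lra.
(* With this [c], the segment point is [c *: y] plus [(1 - a) / (1 + r)] times the same cone vector,
   so the comparison now starts from a multiple of [y]. *)
pose c := (1 + r * a) / (1 + r).
have c0 : 0 < c by rewrite divr_gt0.
have Kc : K° (c *: y) by exact: int_cone_scale.
have := @hess_antitone _ _ _ _ _ hK hF hneg _
  ((1 - a) / (1 + r) *: (r *: x - (y - x))) h Kc.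
have -> : c *: y + (1 - a) / (1 + r) *: (r *: x - (y - x)) = x + a *: (y - x).
  apply/matrixP => i j; rewrite !mxE /c; field.
  by rewrite gt_eqF.
rewrite (hess_homogeneous hK hF)// -scalemxAl innerZl /c invf_div expr_div_n; apply.
apply: (regular_cone_scale hK); first by rewrite divr_ge0//; lra.
by rewrite rE; exact: cone_local_norm.
Qed.

(** The left side is the integral over [[0, 1]] of [r ^+ 2 / (1 + r * a) ^+ 2], which bounds the
    derivative of [inner (grad F _) (y - x)] along the segment from below. *)
Lemma grad_gap x y r : K° x -> K° y -> r = local_norm F x (y - x) ->
  r ^+ 2 / (1 + r) <= inner (grad F y - grad F x) (y - x).
Proof.
move=> Kx Ky rE; rewrite innerBl.
have r0 : 0 <= r by rewrite rE; exact: local_norm_ge0.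
have := @is_derive_le _ (fun a => a * (1 + r * a)^-1 * r ^+ 2)
  (fun a => inner (grad F (x + a *: (y - x))) (y - x))
  (fun a => (1 + r * a) ^- 2 * r ^+ 2)
  (fun a => inner (hess F (x + a *: (y - x)) *m (y - x)) (y - x)) 0 1 ler01.
rewrite scale0r addr0 scale1r subrKC !mul0r subr0 mulr1 mul1r => H.
rewrite mulrC; apply: H => a a01.
- apply: is_derive_mulrc; apply: is_derive_homography.
  by rewrite gt_eqF// ltr_pwDl// mulr_ge0//; lra.
- by apply: (is_derive_grad hF); exact: segment_int.
by rewrite rE local_norm_sqr//; exact: hess_segment_lower.
Qed.

(* A quantitative inverse function theorem: [grad F] expands distances, because
   [inner (grad F y - grad F x) (y - x)] dominates [r^2 / (1 + r)]. *)
Lemma grad_inverse_lipschitz x : K° x ->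
  exists C d : R, [/\ 0 < C, 0 < d & forall y, K° y ->
    `|grad F y - grad F x| < d -> `|y - x| <= C * `|grad F y - grad F x|].
Proof.
move=> Kx; have [C C0 CP] := posdef_norm_le (hess_posdef hK hF Kx).
(* Put [A = n%:R * C * |g|]. The gap gives [r <= A * (1 + r)]; when [k * |g| < 1] one has
   [A <= 1/2], so the term [A * r] is absorbed and [r <= 2 * A <= k * |g|]. *)
pose k := 2 * (1 + n%:R * C).
have nC : 0 <= n%:R * C by rewrite mulr_ge0// ltW.
have k0 : 0 < k by rewrite /k; lra.
exists (C * k), k^-1; split=> [||y Ky]; [exact: mulr_gt0|by rewrite invr_gt0|].
set g := grad F y - grad F x; set r := local_norm F x (y - x) => gk.
have r0 : 0 <= r by exact: local_norm_ge0.
have yr : `|y - x| <= C * r by exact: CP.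
suff : r <= k * `|g|.
  by move=> rk; rewrite -mulrA (le_trans yr)// ler_wpM2l// ltW.
have := grad_gap Kx Ky erefl; rewrite -/r -/g => gap.
have : r ^+ 2 / (1 + r) <= n%:R * C * `|g| * r.
  apply: (le_trans gap); apply: (le_trans (ler_norm _)).
  apply: (le_trans (inner_le_norm _ _)).
  rewrite -!mulrA ler_wpM2l//; apply: (@le_trans _ _ (`|g| * (C * r))).
    by rewrite ler_wpM2l.
  by rewrite le_eqVlt; apply/orP; left; apply/eqP; ring.
rewrite ler_pdivrMr; last by lra.
have [->|rn0] := eqVneq r 0; first by rewrite mulr_ge0// ltW.
have {rn0}r0 : 0 < r by rewrite lt_neqAle eq_sym rn0.
pose A := n%:R * C * `|g|.
rewrite -/A (_ : A * r * (1 + r) = r * (A * (1 + r))); last by ring.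
rewrite expr2 ler_pM2l// mulrDr mulr1 => rA.
have : k * `|g| < 1 by rewrite mulrC -ltr_pdivlMr// mul1r.
have : k * `|g| = 2 * `|g| + 2 * A by rewrite /k /A; ring.
have g0 : 0 <= `|g| by [].
move=> e kg; have A2 : A <= 2^-1 by lra.
have : A * r <= 2^-1 * r by rewrite ler_pM2r.
by rewrite e; lra.
Qed.

End SegmentComparison.

(** * The dual barrier *)

Section ColumnVectors.
Context {R : realType} {n : nat}.
Implicit Types (x v w : 'cV[R]_n) (t : R).

Lemma norm_trmx (v : 'rV[R]_n) : `|v^T| = `|v|.
Proof.
apply/eqP; rewrite eq_le; apply/andP; split.
  apply: norm_le_coord => // i; rewrite mxE.
  by rewrite [leRHS]/Num.Def.normr/= mx_normrE; exact: (le_bigmax _ _ (ord0, i)).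
rewrite [leLHS]/Num.Def.normr/= mx_normrE; apply: bigmax_le => // -[i j] _ /=.
by rewrite ord1; have := le_coord_norm v^T j; rewrite mxE.
Qed.

(** Compactness holds for the ball of row vectors and is carried over by transposition, an isometry
    for the sup norm. *)
Lemma closed_ball_compact (M : R) : compact [set v : 'cV[R]_n | `|v| <= M].
Proof.
have ct : continuous (trmx : 'rV[R]_n -> 'cV[R]_n).
  move=> v; apply/(@cvgrPdist_le _ _ _ _ (nbhs_filter v)) => e e0.
  apply/(nbhs_normP v); exists e => //= w.
  by rewrite /ball_/= -linearB/= norm_trmx => /ltW.
have cM : compact [set v : 'rV[R]_n | `|v| <= M].
  apply: bounded_closed_compact.
    exists M; split => [|y My v /= vM]; first exact: num_real.
    by rewrite (le_trans vM)// ltW.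
  apply: (@closed_comp _ _ (fun v : 'rV[R]_n => `|v|) [set t | t <= M]).
    by move=> v _; exact: norm_continuous.
  exact: closed_le.
have := continuous_compact (continuous_subspaceT ct) cM.
congr compact; apply/seteqP; split=> [_ [v /= vM <-]|v /= vM].
  by rewrite norm_trmx.
by exists v^T => /=; rewrite ?trmxK// -norm_trmx trmxK.
Qed.

Lemma is_derive_of_littleo (g : 'cV[R]_n -> R) x v (l : R) :
  (forall e, 0 < e -> exists2 d, 0 < d &
    forall t, `|t| < d -> `|g (t *: v + x) - g x - t * l| <= e * `|t|) ->
  is_derive x v g l.
Proof.
move=> H; suff c : (fun t => t^-1 *: (g (t *: v + x) - g x)) @ 0^' --> l.
  by apply: DeriveDef; [apply/cvg_ex; exists l|exact: cvg_lim].
apply/cvgrPdist_le => e e0; have [d d0 dP] := H e e0; near=> t.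
have t0 : t != 0 by near: t; exact: nbhs_dnbhs_neq.
have td : `|t| < d by near: t; exact: dnbhs0_lt.
rewrite distrC -(@ler_pM2r _ `|t|) ?normr_gt0// -normrM mulrBl.
by rewrite /GRing.scale/= mulrAC mulVf// mul1r [l * t]mulrC dP.
Unshelve. all: by end_near. Qed.

Lemma differentiable_littleo (g : 'cV[R]_n -> R) x (e : R) :
  differentiable g x -> 0 < e -> \forall v \near (0 : 'cV[R]_n),
  `|g (x + v) - g x - \sum_i v i 0 * partial i g x| <= e * `|v|.
Proof.
move=> gx e0; have /eqaddoP/(_ e e0) := diff_locally gx.
apply: filterS => v; rewrite -deriveE_partial// deriveE// [x + v]addrC.
apply: le_trans; rewrite le_eqVlt; apply/orP; left; apply/eqP; congr (`| _ |).
by rewrite -addrA -opprD.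
Qed.

End ColumnVectors.

Lemma ln_le_linear (R : realType) (a : R) : 0 < a ->
  exists C : R, forall y, 0 < y -> ln y <= a * y + C.
Proof.
move=> a0; exists (- ln a) => y y0.
have : ln (a * y) < a * y by apply: ln_sublinear; rewrite mulr_gt0.
by rewrite lnM ?posrE//; lra.
Qed.

(** * Attainment of the supremum defining the dual barrier *)

Section Dual.
Context {R : realType} {n : nat} {K : set 'cV[R]_n} {theta : R}
  {F : 'cV[R]_n -> \bar R}.
Hypotheses (hK : regular_cone K) (hF : LHSCB K theta F) (n0 : (0 < n)%N).
Implicit Types (x y u v h s : 'cV[R]_n) (t : R).
Local Notation f := (fine \o F).

(** Homogeneity splits [f x] into its value at the unit vector along [x], bounded below by the
    tangent at a fixed point [e], and [- theta * ln |x|]. Half of the linear growth of [inner s x]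
    pays for the logarithm. *)
Lemma F_coercive s : (dual_cone K)° s ->
  exists a C : R, 0 < a /\ forall x, K° x -> a * `|x| - C <= inner s x + f x.
Proof.
move=> /dual_int_coercive[c c0 cP]; have [e Ke] := regular_cone_solid hK.
have th0 : 0 < theta := theta_gt0 hK hF n0 Ke.
have ct : 0 < c / (2 * theta) by rewrite divr_gt0// mulr_gt0.
have [C0 C0P] := ln_le_linear ct.
pose B := n%:R * `|grad F e| * (1 + `|e|) - f e.
exists (c / 2), (B + theta * C0); split=> [|x Kx]; first by rewrite divr_gt0.
have x0 : 0 < `|x| by rewrite normr_gt0 (int_cone_neq0 hK).
have Ku : K° (`|x|^-1 *: x) by apply: (int_cone_scale hK); rewrite ?invr_gt0.
have fu : - B <= f (`|x|^-1 *: x).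
  apply: le_trans (F_lower hK hF Ke Ku).
  rewrite /B opprB lerD2l lerNl (le_trans (ler_norm _))// normrN.
  apply: (le_trans (inner_le_norm _ _)); rewrite ler_wpM2l ?mulr_ge0//.
  apply: (le_trans (ler_normB _ _)); rewrite lerD2r normrZ ger0_norm ?invr_ge0//.
  by rewrite mulVf// gt_eqF.
have fx : f x = f (`|x|^-1 *: x) - theta * ln `|x|.
  by rewrite -(F_homogeneous hF Ku x0) scalerKV// gt_eqF.
have := cP x (int_cone_sub Kx).
have : theta * ln `|x| <= c / 2 * `|x| + theta * C0.
  have -> : c / 2 * `|x| + theta * C0 = theta * (c / (2 * theta) * `|x| + C0).
    by field; rewrite gt_eqF.
  by rewrite ler_pM2l// C0P.
by rewrite fx; lra.
Qed.

(** The minimisation takes place on a compact piece of the closed epigraph, where the objective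
    [inner s p.1 + p.2] is continuous up to the boundary of the cone. Coercivity yields the bounds
    [M] on points and [M'] on values that contain every competitor no worse than [e]. *)
Lemma F_attained s : (dual_cone K)° s ->
  exists2 x, K° x & forall y, K° y -> inner s x + f x <= inner s y + f y.
Proof.
move=> Ds; have [a [C [a0 aP]]] := F_coercive Ds.
have [e Ke] := regular_cone_solid hK.
pose P0 := inner s e + f e.
pose M := `|P0 + C| / a.
pose M' := `|C| + `|P0| + n%:R * `|s| * M.
have M0 : 0 <= M by rewrite divr_ge0// ltW.
pose A := ([set v : 'cV[R]_n | `|v| <= M] `*` `[- M', M']) `&` epigraph F.
have cA : compact A.
  apply: compact_closedI; last exact: (LHSCB_closed hF).
  by apply: compact_setX; [exact: closed_ball_compact|exact: segment_compact].
have inA x : K° x -> inner s x + f x <= P0 -> A (x, f x).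
  move=> Kx xP; have := aP x Kx => ax.
  have xM : `|x| <= M.
    rewrite ler_pdivlMr// mulrC; have := ler_norm (P0 + C); lra.
  split; last by rewrite /epigraph/= (F_fin hF).
  split => //=; rewrite in_itv/=.
  have sx : `|inner s x| <= n%:R * `|s| * M.
    by apply: (le_trans (inner_le_norm _ _)); rewrite ler_wpM2l// mulr_ge0.
  have := ler_norm (inner s x); have := ler_norm (- inner s x); rewrite normrN.
  have := ler_norm C; have := ler_norm P0; rewrite /M' => h1 h2 h3 h4.
  have := normr_ge0 C; have := normr_ge0 P0.
  have : 0 <= a * `|x| by rewrite mulr_ge0// ltW.
  move=> h5 h6 h7; rewrite -/(f x) in ax xP *.
  by move: (f x) ax xP => fx ax xP; lra.
pose g (p : 'cV[R]_n * R) := inner s p.1 + p.2.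
have cg : continuous g.
  move=> p; have c1 : inner s q.1 @[q --> p] --> inner s p.1.
    by apply: continuous_comp; [exact: cvg_fst|exact: inner_continuous].
  exact: (cvgD c1 cvg_snd).
have [|[x r]] := compact_EVT_min _ cA (continuous_subspaceT cg).
  by exists (e, f e); apply: inA.
rewrite inE => -[_ epx] /= mP.
have Kx : K° x.
  apply: contrapT => nKx; move: epx; rewrite /epigraph/= (LHSCB_out hF)//.
move: epx; rewrite /epigraph/= (F_fin hF Kx) lee_fin => fr.
have le_e : inner s x + f x <= P0.
  have := mP (e, f e); rewrite inE => /(_ (inA e Ke (lexx _))).
  by rewrite /g/= -/P0; apply: le_trans; rewrite lerD2l.
exists x => // y Ky; have [yP|/ltW yP] := leP (inner s y + f y) P0; last first.
  exact: le_trans yP.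
have := mP (y, f y); rewrite inE => /(_ (inA y Ky yP)).
by rewrite /g/=; apply: le_trans; rewrite lerD2l.
Qed.

Lemma grad_surj s : (dual_cone K)° s -> exists2 x, K° x & grad F x = - s.
Proof.
move=> /F_attained[x Kx xP]; exists x => //.
suff H v : inner s v + inner (grad F x) v = 0.
  apply/matrixP => i j; rewrite ord1 [RHS]mxE; have := H (delta_mx i 0).
  by rewrite !inner_delta; move/eqP; rewrite addrC addr_eq0 => /eqP.
have [d d0 dK] := int_cone_line v Kx.
pose p t := inner s (x + t *: v) + f (x + t *: v).
have pd t : - d <= t <= d -> is_derive t 1 p
    (inner s v + inner (grad F (x + t *: v)) v).
  move=> td; apply: is_deriveD; last by apply: (is_derive_F hF); exact: dK.
  under eq_fun do rewrite innerDr innerZr.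
  have := is_deriveD (is_derive_cst (inner s x) t 1)
    (is_derive_mulrc (inner s v) (is_derive_id t 1)).
  by rewrite add0r mul1r.
have : is_derive (0 : R) 1 p 0.
  apply: (@derive1_at_min R p (- d) d 0).
  - by lra.
  - by move=> t; rewrite in_itv/= => td; have [|//] := pd t; lra.
  - by rewrite in_itv/=; lra.
  - move=> t; rewrite in_itv/= => td; rewrite /p scale0r addr0; apply: xP.
    by apply: dK; lra.
move=> [_].
have [|_] := pd 0; first by lra.
by rewrite scale0r addr0 => <-.
Qed.

Lemma grad_argmin s x y : K° x -> K° y -> grad F x = - s ->
  inner s x + f x <= inner s y + f y.
Proof.
move=> Kx Ky gx; have := F_lower hK hF Kx Ky; rewrite gx innerNl innerBr.
by move: (f x) (f y) => a b; lra.
Qed.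

Lemma dual_barrierE s x : K° x -> grad F x = - s ->
  dual_barrier K F s = (- inner s x - f x)%:E.
Proof.
move=> Kx gx; apply/eqP; rewrite eq_le; apply/andP; split.
  apply: ge_ereal_sup => _ [y Ky <-]; rewrite (F_fin hF Ky) -EFinB lee_fin.
  have := grad_argmin Kx Ky gx.
  by move: (f x) (f y) => a b; lra.
by apply: ereal_sup_ubound; exists x => //; rewrite (F_fin hF Kx).
Qed.

Lemma dual_open s : (dual_cone K)° s -> exists2 d : R, 0 < d &
  forall v, `|v| < d -> (dual_cone K)° (s + v).
Proof.
move=> Ds; have : nbhs s (dual_cone K)° by exact: nbhs_interior.
move=> /nbhs_normP[d /= d0 dK]; exists d => // v vd.
by apply: dK; rewrite /ball_/= opprD addrA subrr sub0r normrN.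
Qed.

End Dual.

(* The inverse of [- grad F], i.e. the point at which the supremum defining the
   dual barrier is attained; a junk value outside the interior of the dual cone. *)
Definition dual_point (R : realType) (n : nat) (K : set 'cV[R]_n)
    (F : 'cV[R]_n -> \bar R) (s : 'cV[R]_n) : 'cV[R]_n :=
  xget 0 [set x | K° x /\ grad F x = - s].

(** * First and second derivatives of the dual barrier *)

Section DualDerivatives.
Context {R : realType} {n : nat} {K : set 'cV[R]_n} {theta : R}
  {F : 'cV[R]_n -> \bar R}.
Hypotheses (hK : regular_cone K) (hF : LHSCB K theta F)
  (hneg : negative_curvature K F) (n0 : (0 < n)%N).
Implicit Types (x y u v h s : 'cV[R]_n) (t : R).
Local Notation f := (fine \o F).
Local Notation fd := (fine \o dual_barrier K F).

Lemma grad_littleo x (e : R) : K° x -> 0 < e -> \forall v \near (0 : 'cV[R]_n),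
  `|grad F (x + v) - grad F x - hess F x *m v| <= e * `|v|.
Proof.
move=> Kx e0.
have : \forall v \near (0 : 'cV[R]_n), forall i, `|partial i f (x + v) -
    partial i f x - \sum_j v j 0 * partial j (partial i f) x| <= e * `|v|.
  apply: (filter_forall (nbhs_filter (0 : 'cV[R]_n))) => i.
  apply: differentiable_littleo => //.
  exact: (differentiable_partial hF).
apply: filterS => v H; apply: norm_le_coord => [|i]; first by rewrite mulr_ge0// ltW.
have -> : (grad F (x + v) - grad F x - hess F x *m v) i 0 = partial i f (x + v) -
    partial i f x - \sum_j v j 0 * partial j (partial i f) x.
  rewrite !mxE; congr (_ - _); apply: eq_bigr => j _.
  by rewrite mxE mulrC.
exact: H.
Qed.

Lemma dual_pointP s : (dual_cone K)° s ->
  K° (dual_point K F s) /\ grad F (dual_point K F s) = - s.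
Proof.
move=> /(grad_surj hK hF n0)[x Kx gx]; rewrite /dual_point.
by case: xgetP => [y _ //|/(_ x)[]].
Qed.

Lemma dual_point_lipschitz s : (dual_cone K)° s ->
  exists C d : R, [/\ 0 < C, 0 < d & forall v, `|v| < d ->
    (dual_cone K)° (s + v) /\
    `|dual_point K F (s + v) - dual_point K F s| <= C * `|v|].
Proof.
move=> Ds; have [Kx gx] := dual_pointP Ds.
have [C [d [C0 d0 CP]]] := grad_inverse_lipschitz hK hF hneg Kx.
have [d' d'0 dP] := dual_open Ds.
exists C, (Num.min d d'); split=> // [|v]; first by rewrite lt_min d0.
rewrite lt_min => /andP[vd vd'].
have Dv := dP v vd'; split => //; have [Ky gy] := dual_pointP Dv.
have := CP _ Ky; rewrite gy gx opprK opprD addrAC addNr add0r normrN; exact.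
Qed.

(** Envelope argument: let [x] and [y] be the dual points of [s] and [s + t *: v]. Testing each
    optimality against the other point puts the first-order error between 0 and
    [- t * inner v (y - x)], which is quadratic in [t] by the Lipschitz estimate. *)
Lemma dual_barrier_is_derive s v : (dual_cone K)° s ->
  is_derive s v fd (- inner v (dual_point K F s)).
Proof.
move=> Ds; apply: is_derive_of_littleo => e e0.
have [C [d [C0 d0 CP]]] := dual_point_lipschitz Ds.
have [Kx gx] := dual_pointP Ds.
set x := dual_point K F s in Kx gx CP *.
pose B := n%:R * `|v| * C * `|v|.
have B0 : 0 <= B by rewrite !mulr_ge0// ltW.
exists (Num.min (d / (1 + `|v|)) (e / (1 + B))).
  by rewrite lt_min !divr_gt0// ltr_pwDl.
move=> t; rewrite lt_min !ltr_pdivlMr ?ltr_pwDl// => /andP[td te].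
have tv : `|t *: v| < d.
  by rewrite normrZ; apply: le_lt_trans td; rewrite ler_wpM2l// lerDr.
have [Dt yx] := CP _ tv; have [Ky gy] := dual_pointP Dt.
set y := dual_point K F (s + t *: v) in Ky gy yx *.
rewrite [t *: v + s]addrC /= (dual_barrierE hK hF Kx gx) (dual_barrierE hK hF Ky gy).
rewrite /= -/(f x) -/(f y) innerDl innerZl.
have := grad_argmin hK hF Kx Ky gx; have := grad_argmin hK hF Ky Kx gy.
rewrite !innerDl !innerZl; move: (f x) (f y) => a b h1 h2.
have h3 : `|t * inner v (y - x)| <= e * `|t|.
  rewrite normrM mulrC ler_wpM2r//.
  apply: (le_trans (inner_le_norm _ _)).
  apply: (@le_trans _ _ (n%:R * `|v| * (C * (`|t| * `|v|)))).
    by rewrite ler_wpM2l ?mulr_ge0// -normrZ.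
  rewrite (_ : n%:R * `|v| * (C * (`|t| * `|v|)) = `|t| * B);
    last by rewrite /B; ring.
  by apply: le_trans (ltW te); rewrite ler_wpM2l// lerDr.
apply: le_trans h3; rewrite innerBr.
rewrite ger0_norm; last by lra.
by rewrite -normrN; apply: le_trans (ler_norm _); lra.
Qed.

Lemma partial_dual i s : (dual_cone K)° s -> partial i fd s = - dual_point K F s i 0.
Proof.
move=> Ds; have [_] := dual_barrier_is_derive (delta_mx i 0) Ds.
by rewrite innerC inner_delta.
Qed.

Lemma shadow_xE s : (dual_cone K)° s -> shadow_x K F s = dual_point K F s.
Proof.
move=> Ds; apply/matrixP => i j; rewrite ord1 !mxE.
by apply: (canLR (@opprK _)); exact: partial_dual.
Qed.

(** For the dual points [x] of [s] and [y] of [s + t *: v], the gradient increment is exactly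
    [- (t *: v)]. Hence [E = - (t *: v) - H *m (y - x)] is small compared with [y - x], thus with
    [t], and row [i] of [invmx H] turns it into the wanted error. *)
Lemma dual_point_is_derive s v i : (dual_cone K)° s ->
  is_derive s v (fun s => - dual_point K F s i 0)
    ((invmx (hess F (dual_point K F s)) *m v) i 0).
Proof.
move=> Ds; apply: is_derive_of_littleo => e e0.
have [C [d [C0 d0 CP]]] := dual_point_lipschitz Ds.
have [Kx gx] := dual_pointP Ds.
set x := dual_point K F s in Kx gx CP *; set H := hess F x.
have uH : H \in unitmx by apply: posdef_unitmx; exact: (hess_posdef hK hF).
pose r := (row i (invmx H))^T.
have rE w : (invmx H *m w) i 0 = inner r w.
  by rewrite innerE mxE; apply: eq_bigr => j _; rewrite !mxE.
pose B := n%:R * `|r| * C * `|v|.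
have B0 : 0 <= B by rewrite !mulr_ge0// ltW.
have e1 : 0 < e / (1 + B) by rewrite divr_gt0// ltr_pwDl.
have /nbhs_normP[d1 /= d10 d1P] := grad_littleo Kx e1.
have v0 : 0 < 1 + `|v| by rewrite ltr_pwDl.
have Cv0 : 0 < C * (1 + `|v|) by rewrite mulr_gt0.
exists (Num.min (d / (1 + `|v|)) (d1 / (C * (1 + `|v|)))).
  by rewrite lt_min !divr_gt0.
move=> t; rewrite lt_min !ltr_pdivlMr// => /andP[td td1].
have tv : `|t *: v| < d.
  by rewrite normrZ; apply: le_lt_trans td; rewrite ler_wpM2l// lerDr.
have [Dt yx] := CP _ tv; have [Ky gy] := dual_pointP Dt.
rewrite [t *: v + s]addrC.
set y := dual_point K F (s + t *: v) in Ky gy yx *.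
have {}yx : `|y - x| <= C * (`|t| * `|v|) by rewrite -normrZ.
have yd1 : `|y - x| < d1.
  apply: le_lt_trans yx _; apply: le_lt_trans td1.
  by rewrite mulrCA ler_wpM2l// (ler_wpM2l (ltW C0))// lerDr.
have := d1P (y - x); rewrite /ball_/= sub0r normrN => /(_ yd1).
have gE : - (s + t *: v) - - s = - (t *: v).
  by rewrite opprK opprD addrAC addNr add0r.
rewrite subrKC gx gy gE -/H.
set E := - (t *: v) - H *m (y - x) => hE.
have -> : - y i 0 - - x i 0 - t * (invmx H *m v) i 0 = inner r E.
  rewrite -rE /E mulmxBr mulKmx// mulmxN -scalemxAr.
  by move: (invmx H *m v) => w; rewrite !mxE; ring.
apply: (le_trans (inner_le_norm _ _)).
apply: (@le_trans _ _ (n%:R * `|r| * (e / (1 + B) * (C * (`|t| * `|v|))))).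
  rewrite ler_wpM2l ?mulr_ge0//; apply: le_trans hE _.
  by rewrite ler_wpM2l// ltW.
have -> : n%:R * `|r| * (e / (1 + B) * (C * (`|t| * `|v|))) =
    e * `|t| * (B / (1 + B)) by rewrite /B; ring.
have B1 : 0 < 1 + B by rewrite ltr_pwDl.
rewrite ler_piMr//; first by rewrite mulr_ge0// ltW.
by rewrite ler_pdivrMr// mul1r lerDr.
Qed.

Lemma dual_hess s : (dual_cone K)° s ->
  hess (dual_barrier K F) s = invmx (hess F (dual_point K F s)).
Proof.
move=> Ds; apply/matrixP => i j; rewrite mxE /partial.
rewrite -/(partial i _) (near_eq_derive (g := fun s => - dual_point K F s i 0)).
  have [_ ->] := dual_point_is_derive (delta_mx j 0) i Ds.
  by rewrite -colE mxE.
have : nbhs s (dual_cone K)° by exact: nbhs_interior.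
by apply: filterS => z; exact: partial_dual.
Qed.

End DualDerivatives.

(** * The integral scaling *)

Section Integral.
Context {R : realType}.
Local Notation mu := (@lebesgue_measure R).
Implicit Types (f g df : R -> R) (a b : R).

Lemma is_derive_integrable f df a b :
  (forall t, a <= t <= b -> is_derive t 1 f (df t)) ->
  mu.-integrable `[a, b] (EFin \o f).
Proof.
move=> fd; apply: continuous_compact_integrable; first exact: segment_compact.
exact: is_derive_within_continuous fd.
Qed.

Lemma Rintegral_sum (I : finType) (D : set R) (F : I -> R -> R) :
  measurable D -> (forall i, mu.-integrable D (EFin \o F i)) ->
  \int[mu]_(t in D) (\sum_i F i t) = \sum_i \int[mu]_(t in D) F i t.
Proof.
move=> mD iF.
suff [_ <-] : mu.-integrable D (EFin \o (fun t => \sum_i F i t)) /\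
  \int[mu]_(t in D) (\sum_i F i t) = \sum_i \int[mu]_(t in D) F i t by [].
elim: (index_enum I) => [|i s [is_ es]].
  have -> : (fun t => \sum_(i <- [::]) F i t) = cst 0.
    by apply/funext => t; rewrite big_nil.
  by rewrite big_nil Rintegral_cst// mul0r; split=> //; exact: integrable0.
split.
  rewrite (_ : _ \o _ = (EFin \o F i) \+ (EFin \o fun t => \sum_(j <- s) F j t)).
    exact: integrableD.
  by apply/funext => t; rewrite /= big_cons EFinD.
rewrite big_cons -es -RintegralD//.
by apply: eq_Rintegral => t _; rewrite big_cons.
Qed.

(** The derivative [df] of the integrand supplies its continuity; for Hessian entries it is the
    third derivative of the barrier. *)
Lemma Rintegral_derive g f df a b : a < b ->
  (forall t, a <= t <= b -> is_derive t 1 g (f t)) ->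
  (forall t, a <= t <= b -> is_derive t 1 f (df t)) ->
  \int[mu]_(t in `[a, b]) f t = g b - g a.
Proof.
move=> ab gd fd; rewrite /Rintegral (continuous_FTC2 (F := g))//.
- exact: is_derive_within_continuous fd.
- have gc t : a <= t <= b -> {for t, continuous g}.
    move=> /gd[gt _]; apply: differentiable_continuous; exact/derivable1_diffP.
  split.
  + move=> t; rewrite in_itv/= => /andP[/ltW at_ /ltW tb].
    by have [|] := gd t; rewrite ?at_.
  + by apply: cvg_at_right_filter; apply: gc; rewrite lexx ltW.
  + by apply: cvg_at_left_filter; apply: gc; rewrite lexx ltW.
- move=> t; rewrite in_itv/= => /andP[/ltW at_ /ltW tb].
  by rewrite derive1E; have [|_] := gd t; rewrite ?at_.
Qed.

Lemma Rintegral_homography (r c : R) : 0 <= r ->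
  mu.-integrable `[0, 1] (EFin \o (fun a => (1 + r * a) ^- 2 * c)) /\
  \int[mu]_(a in `[0, 1]) ((1 + r * a) ^- 2 * c) = c / (1 + r).
Proof.
move=> r0.
have ra a : 0 <= a <= 1 -> 0 < 1 + r * a.
  by move=> a01; rewrite ltr_pwDl// mulr_ge0//; lra.
have d2 (a : R) : 0 <= a <= 1 -> is_derive a 1 (fun a => (1 + r * a) ^- 2 * c)
    (- (1 + r * a) ^- 2 ^+ 2 * (2 * (1 + r * a) * r) * c).
  move=> a01; apply: is_derive_mulrc.
  have nz : (1 + r * a) ^+ 2 != 0 by rewrite expf_neq0// gt_eqF// ra.
  have := is_deriveV (f := fun a => (1 + r * a) ^+ 2) nz
    (is_deriveX 2 (is_derive_affine r a)).
  move=> [d e]; apply: DeriveDef; first exact: d.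
  by apply: (etrans e); rewrite /GRing.scale/= exprVn expr1 -exprM.
split; first exact: is_derive_integrable d2.
have gd (a : R) : 0 <= a <= 1 -> is_derive a 1 (fun a => a * (1 + r * a)^-1 * c)
    ((1 + r * a) ^- 2 * c).
  move=> a01; apply: is_derive_mulrc; apply: is_derive_homography.
  by rewrite gt_eqF// ra.
apply: etrans (Rintegral_derive ltr01 gd d2) _.
by rewrite !mul0r mulr1 mul1r subr0 mulrC.
Qed.

End Integral.

(** With [w] equal to mu times x~, this is [integral_scaling] before multiplication by mu. *)
Definition mean_hess (R : realType) (n : nat) (F : 'cV[R]_n -> \bar R)
    (x w : 'cV[R]_n) : 'M[R]_n :=
  \matrix_(i, j) \int[lebesgue_measure]_(a in `[0, 1])
    hess F (x + a *: (w - x)) i j.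

(** * Secant equations and bounds for the mean Hessian *)

Section Scaling.
Context {R : realType} {n : nat} {K : set 'cV[R]_n} {theta : R}
  {F : 'cV[R]_n -> \bar R}.
Hypotheses (hK : regular_cone K) (hF : LHSCB K theta F)
  (hneg : negative_curvature K F).
Implicit Types (x y w u v h s : 'cV[R]_n) (t : R).
Local Notation leb := (@lebesgue_measure R).

Section Segment.
Context {x w : 'cV[R]_n}.
Hypotheses (Kx : K° x) (Kw : K° w).
Let p := w - x.

Lemma segment_hess_is_derive v u t : 0 <= t <= 1 ->
  is_derive t 1 (fun t => inner (hess F (x + t *: p) *m v) u)
    (inner (third F (x + t *: p) p *m v) u).
Proof. by move=> t01; apply: (is_derive_hess hF); exact: segment_int. Qed.

Lemma hess_integrable v u :
  leb.-integrable `[0, 1] (EFin \o (fun t => inner (hess F (x + t *: p) *m v) u)).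
Proof. exact: is_derive_integrable (segment_hess_is_derive v u). Qed.

Lemma inner_mean_hess v u : inner (mean_hess F x w *m v) u =
  \int[leb]_(a in `[0, 1]) inner (hess F (x + a *: p) *m v) u.
Proof.
have He a i j : hess F (x + a *: p) i j =
    inner (hess F (x + a *: p) *m delta_mx j 0) (delta_mx i 0).
  by rewrite inner_delta -colE [RHS]mxE.
have Hi i j : leb.-integrable `[0, 1] (EFin \o (fun a => hess F (x + a *: p) i j)).
  rewrite (funext (fun a => He a i j)); exact: hess_integrable.
have HiZ i j : leb.-integrable `[0, 1]
    (EFin \o (fun a => hess F (x + a *: p) i j * v j 0)).
  rewrite (_ : (fun a => _ * _) = fun a =>
    inner (hess F (x + a *: p) *m delta_mx j 0) (v j 0 *: delta_mx i 0)).
    exact: hess_integrable.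
  by apply/funext => a; rewrite innerZr -He mulrC.
transitivity (\sum_i \int[leb]_(a in `[0, 1])
    ((hess F (x + a *: p) *m v) i 0 * u i 0)).
  rewrite innerE; apply: eq_bigr => i _.
  rewrite RintegralZr//; last first.
    have := hess_integrable v (delta_mx i 0).
    by rewrite (funext (fun a => inner_delta (hess F (x + a *: p) *m v) i)).
  congr (_ * _); rewrite mxE; under eq_Rintegral do rewrite mxE.
  rewrite Rintegral_sum//; apply: eq_bigr => j _.
  by rewrite mxE RintegralZr.
rewrite -Rintegral_sum//.
  by apply: eq_Rintegral => a _; rewrite innerE.
move=> i; have := hess_integrable v (u i 0 *: delta_mx i 0).
rewrite (_ : (fun a => inner _ _) =
  fun a => (hess F (x + a *: p) *m v) i 0 * u i 0)//.
by apply/funext => a; rewrite innerZr inner_delta mulrC.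
Qed.

Lemma mean_hess_direction : mean_hess F x w *m p = grad F w - grad F x.
Proof.
apply/matrixP => i j; rewrite ord1 -!inner_delta inner_mean_hess.
have gd t : 0 <= t <= 1 -> is_derive t 1
    (fun t => inner (grad F (x + t *: p)) (delta_mx i 0))
    (inner (hess F (x + t *: p) *m p) (delta_mx i 0)).
  by move=> t01; apply: (is_derive_grad hF); exact: segment_int.
have fd := segment_hess_is_derive p (delta_mx i 0).
apply: etrans (Rintegral_derive ltr01 gd fd) _.
by rewrite scale0r addr0 scale1r /p subrKC innerBl.
Qed.

(** Write [x] as the segment point minus [t *: p]. Since the Hessian sends the segment point to
    minus the gradient there, [- t] times the gradient is an antiderivative of the integrand. *)
Lemma mean_hess_base : mean_hess F x w *m x = - grad F w.
Proof.
apply/matrixP => i j; rewrite ord1 -!inner_delta inner_mean_hess.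
pose g t := inner (grad F (x + t *: p)) (delta_mx i 0).
have gd t : 0 <= t <= 1 -> is_derive t 1 (fun t => - (t * g t))
    (inner (hess F (x + t *: p) *m x) (delta_mx i 0)).
  move=> t01; have Kt : K° (x + t *: p) by exact: segment_int.
  have dg : is_derive t 1 g (inner (hess F (x + t *: p) *m p) (delta_mx i 0)).
    exact: (is_derive_grad hF).
  have := is_deriveN (is_deriveM (is_derive_id t (1 : R)) dg).
  move=> [d e]; apply: DeriveDef; first exact: d.
  apply: (etrans e); rewrite /GRing.scale/= mulr1.
  have -> : hess F (x + t *: p) *m x =
      - grad F (x + t *: p) - t *: (hess F (x + t *: p) *m p).
    by rewrite -(hess_mul_self hK hF Kt) scalemxAr -mulmxBr addrK.
  by rewrite innerBl innerZl innerNl -/(g t); ring.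
have fd := segment_hess_is_derive x (delta_mx i 0).
apply: etrans (Rintegral_derive ltr01 gd fd) _.
by rewrite mul0r oppr0 subr0 mul1r /g scale1r /p subrKC innerNl.
Qed.

Lemma mean_hess_symm : (mean_hess F x w)^T = mean_hess F x w.
Proof.
apply/matrixP => i j; rewrite !mxE; apply: eq_Rintegral => a.
rewrite inE/= in_itv/= => a01.
have [/matrixP/(_ i j) <- _] := hess_posdef hK hF (segment_int hK a01 Kx Kw).
by rewrite [RHS]mxE.
Qed.

Lemma mean_hess_lower h :
  inner (hess F x *m h) h / (1 + local_norm F x p) <= inner (mean_hess F x w *m h) h.
Proof.
rewrite inner_mean_hess.
have [ih <-] := Rintegral_homography (inner (hess F x *m h) h)
  (local_norm_ge0 (F := F) x p).
apply: le_Rintegral => //; first exact: hess_integrable.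
by move=> a; rewrite /= in_itv/= => a01; exact: (hess_segment_lower hK hF hneg).
Qed.

Lemma mean_hess_upper h :
  inner (mean_hess F x w *m h) h <= (1 + local_norm F x p) * inner (hess F w *m h) h.
Proof.
rewrite inner_mean_hess; set r := local_norm F x p.
have r0 : 0 <= r by exact: local_norm_ge0.
have [ih eh] := Rintegral_homography ((1 + r) ^+ 2 * inner (hess F w *m h) h) r0.
have -> : (1 + r) * inner (hess F w *m h) h =
    (1 + r) ^+ 2 * inner (hess F w *m h) h / (1 + r) by field; rewrite gt_eqF//; lra.
rewrite -eh; apply: le_Rintegral => //; first exact: hess_integrable.
move=> a; rewrite /= in_itv/= => a01; rewrite mulrCA mulrA.
exact: (hess_segment_upper hK hF hneg).
Qed.

End Segment.
End Scaling.

Lemma four_thirds_bound (R : realFieldType) (r g : R) :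
  0 <= r -> r ^+ 2 / (1 + r) <= g -> 0 <= g /\ 1 + r <= 4 / 3 * (1 + g).
Proof.
move=> r0; have r1 : 0 < 1 + r by lra.
move=> gap; split.
  by apply: le_trans gap; rewrite divr_ge0 ?sqr_ge0 ?ltW.
move: gap; rewrite ler_pdivrMr// => gap; rewrite -(ler_pM2r r1).
by move: gap (sqr_ge0 (1 - r)); rewrite !expr2; lra.
Qed.

Lemma scale_lower (R : realFieldType) (m D r q : R) :
  0 < m -> 0 < D -> 0 <= r -> 1 + r <= m * D -> 0 <= q ->
  D^-1 * q <= m * (q / (1 + r)).
Proof.
move=> m0 D0 r0 rD q0; have r1 : 0 < 1 + r by lra.
rewrite mulrCA [leRHS]mulrC ler_wpM2r// ler_pdivlMr//.
by rewrite mulrC ler_pdivrMr.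
Qed.

Lemma scale_upper (R : realFieldType) (m D r q : R) :
  0 < m -> 1 + r <= m * D -> 0 <= q ->
  m * ((1 + r) * (m^-1 ^+ 2 * q)) <= D * q.
Proof.
move=> m0 rD q0.
have -> : m * ((1 + r) * (m^-1 ^+ 2 * q)) = (1 + r) / m * q.
  by field; rewrite gt_eqF.
by rewrite ler_wpM2r// ler_pdivrMr// mulrC.
Qed.

Section Scalings.
Context {R : realType} {n : nat} {K : set 'cV[R]_n} {theta : R}
  {F : 'cV[R]_n -> \bar R}.
Hypotheses (hK : regular_cone K) (hF : LHSCB K theta F)
  (hneg : negative_curvature K F).

(** Positivity of [theta] is obtained only for [n > 0]; in dimension zero all matrices of a given
    shape coincide. *)
Lemma integral_scaling_mem0 (x s : 'cV[R]_n) (xi : R) : n = 0%N ->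
  scalings K theta F x s xi (integral_scaling K theta F x s).
Proof.
move=> n0; have eq0 m (A B : 'M[R]_(n, m)) : A = B.
  by apply/matrixP => i; have := ltn_ord i; rewrite [X in (_ < X)%N]n0.
have psd0 (A : 'M[R]_n) : psd A.
  by split=> [|v]; [exact: eq0|rewrite (eq0 _ v 0) innerC inner0l].
split; try exact: eq0; try exact: psd0.
by split=> [|v /eqP[]]; exact: eq0.
Qed.

Lemma integral_scaling_mem (x s : 'cV[R]_n) : (0 < n)%N ->
  K° x -> (dual_cone K)° s ->
  scalings K theta F x s (4 / 3) (integral_scaling K theta F x s).
Proof.
move=> n0 Kx Ds; have th0 := theta_gt0 hK hF n0 Kx.
have [Kz gz] := dual_pointP hK hF n0 Ds.
have xE := shadow_xE hK hF hneg n0 Ds.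
have hE := dual_hess hK hF hneg n0 Ds.
set z := dual_point K F s in Kz gz xE hE.
have [m mE] : exists m, mu theta x s = m by exists (mu theta x s).
have sx : inner s x = theta * m by rewrite -mE /mu mulrC divfK// gt_eqF.
have m0 : 0 < m.
  have [c c0 cP] := dual_int_coercive Ds.
  have := cP x (int_cone_sub Kx); rewrite sx => h.
  rewrite -(pmulr_rgt0 _ th0); apply: lt_le_trans h.
  by rewrite mulr_gt0// normr_gt0 (int_cone_neq0 hK).
have mN0 : m != 0 by rewrite gt_eqF.
pose w := m *: z.
have Kw : K° w by exact: int_cone_scale.
have gw : grad F w = - (m^-1 *: s) by rewrite (grad_homogeneous hK hF)// gz scalerN.
pose p := w - x.
have [r r0 rE] : exists2 r, 0 <= r & r = local_norm F x p.
  by exists (local_norm F x p) => //; exact: local_norm_ge0.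
have TE : integral_scaling K theta F x s = m *: mean_hess F x w.
  rewrite /integral_scaling xE mE; apply: (congr1 ( *:%R m)).
  apply/matrixP => i j; rewrite [LHS]mxE [RHS]mxE; apply: eq_Rintegral => a _.
  congr (fun_of_matrix (hess F _) i j).
  rewrite scalerBr scalerBl scale1r scalerA addrA.
  by rewrite [RHS]addrAC.
have [gam gamE] : exists gam, gam = - inner (grad F x) p by eexists.
have gx := inner_grad_self hF Kx.
(* Here the scaling by [m] matters: [inner s x = theta * m] makes the pairings of [grad F w] with
   [w] and with [x] both equal to [- theta]. *)
have gwp : inner (grad F w) p = 0.
  rewrite /p innerBr (inner_grad_self hF Kw) gw innerNl innerZl sx.
  by rewrite mulrCA (mulVf mN0) mulr1 opprK addNr.
have gap : r ^+ 2 / (1 + r) <= gam.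
  by have := grad_gap hK hF hneg Kx Kw rE; rewrite innerBl gwp sub0r gamE.
have dE : delta K theta F x s = (1 + gam) / m.
  rewrite /delta mE; congr (_ / _).
  have : inner (grad F x) w = - theta - gam.
    by rewrite gamE /p innerBr gx; ring.
  rewrite /mu_tilde /shadow_s xE /w innerZr innerNl => e.
  have -> : theta * (m * (- inner (grad F x) z / theta) - 1) + 1 =
      1 - theta - m * inner (grad F x) z by field; rewrite gt_eqF.
  by rewrite e; ring.
have [gam0 key] := four_thirds_bound r0 gap.
have [D DE] : exists D, 4 / 3 * delta K theta F x s = D by eexists.
rewrite dE in DE.
have D0 : 0 < D by rewrite -DE !mulr_gt0 ?invr_gt0 ?ltr_pwDl.
have mD : m * D = 4 / 3 * (1 + gam) by rewrite -DE; field.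
have [Hx HxE] : exists Hx, hess F x = Hx by eexists.
have [Hz HzE] : exists Hz, hess F z = Hz by eexists.
have Hx_posdef : posdef Hx by rewrite -HxE; exact: (hess_posdef hK hF).
have Hz_posdef : posdef Hz by rewrite -HzE; exact: (hess_posdef hK hF).
have [M [TM Ms Mw Mx] [Ml Mu]] : exists2 M : 'M[R]_n,
    [/\ integral_scaling K theta F x s = m *: M, M^T = M,
        M *m w = - grad F x & M *m x = m^-1 *: s] &
    (forall h, inner (Hx *m h) h / (1 + r) <= inner (M *m h) h) /\
    (forall h, inner (M *m h) h <= (1 + r) * (m^-1 ^+ 2 * inner (Hz *m h) h)).
  exists (mean_hess F x w); split.
  - exact: TE.
  - exact: (mean_hess_symm hK hF).
  (* Splitting [w] as [(w - x) + x] adds the two secant equations, and [grad F w] cancels. As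
     [w = m *: z], this becomes the second linear condition on the scaling. *)
  - rewrite -[X in _ *m X](subrK x w) mulmxDr (mean_hess_direction hK hF Kx Kw).
    by rewrite (mean_hess_base hK hF Kx Kw) addrAC subrr add0r.
  - by rewrite (mean_hess_base hK hF Kx Kw) gw opprK.
  - move=> h; have := mean_hess_lower hK hF hneg Kx Kw h.
    rewrite -rE HxE; exact.
  - move=> h; have := mean_hess_upper hK hF hneg Kx Kw h.
    rewrite {2}/w (hess_homogeneous hK hF Kz m0) HzE -scalemxAl innerZl -rE; exact.
rewrite -mD in key.
have lower h : D^-1 * inner (Hx *m h) h <= m * inner (M *m h) h.
  apply: le_trans (scale_lower m0 D0 r0 key (posdef_ge0 h Hx_posdef)) _.
  by rewrite (ler_pM2l m0) Ml.
have upper h : m * inner (M *m h) h <= D * inner (Hz *m h) h.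
  apply: le_trans (scale_upper m0 key (posdef_ge0 h Hz_posdef)).
  by rewrite (ler_pM2l m0) Mu.
have scaleT (c d : R) (A B : 'M[R]_n) : A^T = A -> B^T = B ->
    (c *: A - d *: B)^T = c *: A - d *: B.
  by move=> eA eB; apply/matrixP => i j; rewrite !mxE -{1}eA -{1}eB !mxE.
rewrite TM; split; rewrite ?hE ?xE ?dE ?DE ?HxE ?HzE.
- split=> [|h h0]; first by rewrite linearZ/= Ms.
  rewrite -scalemxAl innerZl; apply: lt_le_trans (lower h).
  by apply: mulr_gt0; [rewrite invr_gt0|exact: Hx_posdef.2].
- by rewrite -scalemxAl Mx scalerA (mulfV mN0) scale1r.
- by rewrite -scalemxAl scalemxAr; exact: Mw.
- split=> [|h]; first exact: scaleT Ms Hx_posdef.1.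
  by rewrite mulmxBl -!scalemxAl innerBl !innerZl subr_ge0.
- rewrite invmxK; split=> [|h]; first exact: scaleT Hz_posdef.1 Ms.
  by rewrite mulmxBl -!scalemxAl innerBl !innerZl subr_ge0.
Qed.

End Scalings.

Theorem theorem3p7 (R : realType) (n : nat) (K : set 'cV[R]_n) (theta : R)
    (F : 'cV[R]_n -> \bar R)
    (hK : regular_cone K) (hF : LHSCB K theta F)
    (hneg : negative_curvature K F) :
  (xi_inf K theta F <= (4 / 3)%:E)%E /\
  (forall x s : 'cV[R]_n, K° x -> (dual_cone K)° s ->
    scalings K theta F x s (4 / 3) (integral_scaling K theta F x s)).
Proof.
have mem x s : K° x -> (dual_cone K)° s ->
    scalings K theta F x s (4 / 3) (integral_scaling K theta F x s).
  move=> Kx Ds; have [n0|n0] := posnP n; first exact: integral_scaling_mem0.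
  exact: integral_scaling_mem.
split=> //; apply: ereal_inf_lbound; exists (4 / 3) => //=; split; first by lra.
by move=> x s Kx Ds; exists (integral_scaling K theta F x s); exact: mem.
Qed.
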